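(* Let $m\in\mathbb{N}$. Let $X_1,\dots,X_m,Y$ be independent with $X_i\sim\mathrm{Po}(\lambda_i)$ for $i=1,\dots,m$ and $Y\sim \mathrm{Po}\big(\sum_{i=1}^m\lambda_i\big)$, where $\lambda=(\lambda_1,\dots,\lambda_m)\in(0,\infty)^m$ is unknown, and consider estimation of $\lambda$ on the basis of $(X,Y)$, $X=(X_1,\dots,X_m)$, under the loss $L(d,\lambda)=\sum_{i=1}^m (d_i-\lambda_i)^2/\lambda_i$. Put $X_\cdot=\sum_{i=1}^m X_i$ and $$\hat\lambda^{\mathrm{ML}}(X,Y)=\frac{X_\cdot+Y}{2}\,\frac{X}{X_\cdot},\quad \hat\lambda^{\mathrm{O}}(X,Y)=\frac{X_\cdot+Y+m-1}{2}\,\frac{X}{X_\cdot+m-1},\quad \hat\lambda(X,Y)=\frac{X_\cdot+Y}{2}\,\frac{X}{X_\cdot+m-1},$$ $$\hat\lambda^{\mathrm{O}}(X)=X,\qquad \hat\lambda(X)=X_\cdot\,\frac{X}{X_\cdot+m-1}.$$ Then: (i) If $m\ge2$, the estimators $\hat\lambda^{\mathrm{O}}(X,Y)$ and $\hat\lambda(X,Y)$ are minimax. If $m=1$, they are not minimax, and the estimator $(X_1+Y)/2$ is minimax with constant risk $1/2$. (ii) $\hat\lambda^{\mathrm{ML}}(X,Y)$ is not minimax. (iii) The estimators $\hat\lambda^{\mathrm{O}}(X)$ and $\hat\lambda(X)$, which depend only on $X$, are not minimax.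
   Context: $\mathrm{Po}(\mu)$ is the Poisson distribution with mean $\mu$. The risk of an estimator $\delta$ at $\lambda$ is $E_\lambda[L(\delta(X,Y),\lambda)]$. An estimator is minimax if its supremum risk over $\lambda\in(0,\infty)^m$ equals the infimum, over all estimators $\delta(X,Y)\in\mathbb{R}^m$ based on $(X,Y)$, of the supremum risk. Convention: $0/0$ is read as $0$; thus $\hat\lambda^{\mathrm{ML}}(X,Y)$ is the zero vector when $X=(0,\dots,0)$, and for $m=1$ all of $\hat\lambda^{\mathrm{ML}}(X,Y)$, $\hat\lambda^{\mathrm{O}}(X,Y)$, $\hat\lambda(X,Y)$, $\hat\lambda(X)$ are $0$ when $X_1=0$. *)

(* Defs.v *)
From mathcomp Require Import all_boot all_order all_algebra.
From mathcomp Require Import all_classical all_reals all_analysis.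

Set Implicit Arguments.
Unset Strict Implicit.
Unset Printing Implicit Defensive.

Import Order.TTheory GRing.Theory Num.Theory.
Import numFieldNormedType.Exports.

Local Open Scope classical_set_scope.
Local Open Scope ring_scope.

Definition mutually_independent (d d' : measure_display) (T : measurableType d)
    (T' : measurableType d') (R : realType) (P : probability T R)
    (I : finType) (Z : I -> {mfun T >-> T'}) : Prop :=
  forall (J : {set I}) (A : I -> set T'), (forall i, measurable (A i)) ->
    P (\bigcap_(i in [set` J]) (Z i @^-1` A i)) =
    (\prod_(i in J) P (Z i @^-1` A i))%E.

(* The nat argument of the library's poisson_prob is a dummy: its value does
   not depend on it. *)
Definition Poisson_rv (d : measure_display) (T : measurableType d)
    (R : realType) (P : probability T R) (Z : {mfun T >-> nat}) (mu : R) : Prop :=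
  forall A : set nat, distribution P Z A = poisson_prob mu 0%N A.

Definition pos_param (R : realType) (m : nat) : set 'rV[R]_m :=
  [set l | forall i, 0 < l 0 i].

(* A single sample space with one probability measure P l per parameter l;
   P l is unconstrained when l is outside the parameter space. The index None
   stands for Y in the joint independence of X_1, ..., X_m, Y. *)
Definition Poisson_model (d : measure_display) (T : measurableType d)
    (R : realType) (m : nat) (P : 'rV[R]_m -> probability T R)
    (X : 'I_m -> {mfun T >-> nat}) (Y : {mfun T >-> nat}) : Prop :=
  forall l : 'rV[R]_m, pos_param l ->
    [/\ mutually_independent (P l)
          (fun o : option 'I_m => if o is Some i then X i else Y),
        forall i, Poisson_rv (P l) (X i) (l 0 i) &
        Poisson_rv (P l) Y (\sum_i l 0 i)].

(* Every function is measurable here, the sample (X, Y) being discrete. *)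
Definition estimator (R : realType) (m : nat) : Type :=
  'rV[nat]_m -> nat -> 'rV[R]_m.

Definition loss (R : realType) (m : nat) (e l : 'rV[R]_m) : R :=
  \sum_i (e 0 i - l 0 i) ^+ 2 / l 0 i.

Section risk.
Context (d : measure_display) (T : measurableType d) (R : realType) (m : nat).
Variables (P : 'rV[R]_m -> probability T R).
Variables (X : 'I_m -> {mfun T >-> nat}) (Y : {mfun T >-> nat}).

Definition risk (delta : estimator R m) (l : 'rV[R]_m) : \bar R :=
  'E_(P l)[fun w => loss (delta (\row_i X i w) (Y w)) l].

Definition sup_risk (delta : estimator R m) : \bar R :=
  ereal_sup [set risk delta l | l in @pos_param R m].

Definition minimax (delta : estimator R m) : Prop :=
  sup_risk delta = ereal_inf (range sup_risk).

End risk.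

(* In all the estimators below 0^-1 = 0 implements the convention 0 / 0 = 0:
   a denominator can only vanish when x = 0. *)
Section estimators.
Context (R : realType) (m : nat).
Implicit Types (x : 'rV[nat]_m) (y : nat).

Definition total x : R := \sum_i (x 0%R i)%:R.

Definition vec x : 'rV[R]_m := \row_i (x 0%R i)%:R.

Definition est_ML : estimator R m := fun x y =>
  ((total x + y%:R) / 2) *: ((total x)^-1 *: vec x).

Definition est_O_XY : estimator R m := fun x y =>
  ((total x + y%:R + m%:R - 1) / 2) *: ((total x + m%:R - 1)^-1 *: vec x).

Definition est_XY : estimator R m := fun x y =>
  ((total x + y%:R) / 2) *: ((total x + m%:R - 1)^-1 *: vec x).

Definition est_O_X : estimator R m := fun x _ => vec x.

Definition est_X : estimator R m := fun x _ =>
  total x *: ((total x + m%:R - 1)^-1 *: vec x).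

(* Only used for m = 1, where its single entry is (X_1 + Y) / 2. *)
Definition est_mean : estimator R m := fun x y =>
  \row_i (((x 0%R i)%:R + y%:R) / 2).

End estimators.

Arguments est_ML R m : clear implicits.
Arguments est_O_XY R m : clear implicits.
Arguments est_XY R m : clear implicits.
Arguments est_O_X R m : clear implicits.
Arguments est_X R m : clear implicits.
Arguments est_mean R m : clear implicits.

(* Main.v *)
Require Import Defs.
From mathcomp Require Import all_boot all_order all_algebra.
From mathcomp Require Import all_classical all_reals all_analysis.
From mathcomp Require Import measurable_realfun ring lra.

(** The risk of an arbitrary estimator is an infinite sum over outcomes, possibly infinite, so
    integrating it against the prior would mean exchanging that sum with an integral over l. A
    finite partial sum avoids this: its integral is read off an explicit antiderivative, and the
    limits are taken afterwards, in the order y, then x, then b -> 0. Outcomes with x_i = 0 are left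
    out because the loss divides by l_i, which only a factor l_i of the likelihood can absorb. Under
    the prior X_i = 0 has probability b / (1 + b), so the omission costs nothing in the limit. Since
    k + 1/2 is attained, by [est_XY] for m >= 2 and by [est_mean] for m = 1, an estimator fails to
    be minimax as soon as its risk exceeds this value at a single l. The negative claims therefore
    only need a well-chosen Lam. *)

(* Write S for the sum of the X_i, Lam for the sum of the l_i and k = m - 1. The
   minimax value is k + 1/2.

   Upper bounds: for an estimator c(S, Y) X, Stein's identity for the Poisson law,
   E[X_i g(X, Y)] = l_i E[g(X + e_i, Y)], gives the risk
   E[((S c - Lam)^2 + k S c^2) / Lam], and then evaluates it up to E[1 / (S + k)],
   which is at most 1 / Lam when m >= 2.

   Lower bound: take independent exponential priors of parameter b on the l_i.
   The Bayes estimate of l_i is x_i (s + y + k) / ((s + k) (2 + b)), and the Bayes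
   risk tends to k + 1/2 as b -> 0. Truncating the risk to finitely many outcomes,
   all with x_i >= 1, leaves polynomials in l times exp (- 2 Lam), so the prior
   only has to be integrated against those, one coordinate at a time. *)

Import Order.TTheory GRing.Theory Num.Theory.
Import numFieldNormedType.Exports.

Set Implicit Arguments.
Unset Strict Implicit.
Unset Printing Implicit Defensive.

Local Open Scope classical_set_scope.
Local Open Scope ring_scope.

(** * Independent Poisson variables *)

Section poisson_family.
Context (d : measure_display) (T : measurableType d) (R : realType).
Context (P : probability T R) (I : finType) (Z : I -> {mfun T >-> nat}).
Context (mu : I -> R).
Hypothesis mu_gt0 : forall o, 0 < mu o.
Hypothesis indep : mutually_independent P Z.
Hypothesis law : forall o, Poisson_rv P (Z o) (mu o).

Local Notation C := {ffun I -> nat}.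

Definition joint (w : T) : C := [ffun o => Z o w].

Definition joint_pmf (z : C) : R := \prod_o poisson_pmf (mu o) (z o).

Lemma poisson_pmf_gt0 (r : R) n : 0 < r -> 0 < poisson_pmf r n.
Proof.
by move=> r0; rewrite /poisson_pmf r0 !mulr_gt0 ?expR_gt0 ?exprn_gt0 ?invr_gt0
  ?ltr0n ?fact_gt0.
Qed.

Lemma joint_pmf_gt0 z : 0 < joint_pmf z.
Proof. by apply: prodr_gt0 => o _; exact: poisson_pmf_gt0. Qed.

Lemma joint_preimage1 z :
  joint @^-1` [set z] = \bigcap_(o in [set` [set: I]%SET]) (Z o @^-1` [set z o]).
Proof.
apply/seteqP; split=> w /=; first by move=> <- o _ /=; rewrite ffunE.
by move=> h; apply/ffunP => o; rewrite ffunE; apply: h; rewrite /= inE.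
Qed.

Lemma joint_law z : P (joint @^-1` [set z]) = (joint_pmf z)%:E.
Proof.
rewrite joint_preimage1 indep // /joint_pmf -prodEFin.
apply: eq_big => [i|o _]; first by rewrite inE.
rewrite -[LHS]/(distribution P (Z o) [set z o]) law /poisson_prob mu_gt0.
by rewrite esum_set1 // lee_fin poisson_pmf_ge0.
Qed.

Lemma measurable_joint1 z : measurable (joint @^-1` [set z]).
Proof.
rewrite joint_preimage1; apply: fin_bigcap_measurable => // o _.
by rewrite -[X in measurable X]setTI; exact: measurable_funP.
Qed.

(** Enumerating [C] by [pickle] turns the fibres of [joint] into a sequence, so that countable
    additivity applies; a number that codes no vector gives the empty set. *)
Lemma preimage_joint_pickle n :
  joint @^-1` [set z | pickle z = n] =
  if pickle_inv n is Some z then joint @^-1` [set z] else set0.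
Proof.
case E: pickle_inv => [z|].
- have := @pickle_invK C n; rewrite E /= => h.
  apply/seteqP; split => w /=; last by move=> ->.
  by move=> hn; move: E; rewrite -hn pickleK_inv => -[].
- by apply/seteqP; split => w //= h; move: E; rewrite -h pickleK_inv.
Qed.

Lemma measurable_preimage_joint (A : set C) : measurable (joint @^-1` A).
Proof.
rewrite (_ : _ @^-1` _ =
  \bigcup_n (if pickle_inv n is Some z then
    if z \in A then joint @^-1` [set z] else set0 else set0)).
  apply: bigcup_measurable => n _; case: pickle_inv => // z.
  by case: ifP => // _; exact: measurable_joint1.
apply/seteqP; split => w /=.
  move=> Aw; exists (pickle (joint w)) => //.
  by rewrite pickleK_inv mem_set.
move=> [n _]; case: pickle_inv => // z.
by case: ifPn => // /set_mem Az /= ->.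
Qed.

Lemma measurable_fun_joint (g : C -> R) : measurable_fun setT (fun w => g (joint w)).
Proof.
move=> _ Y mY; rewrite setTI.
exact: (measurable_preimage_joint (g @^-1` Y)).
Qed.

(** The integrand is constant on each fibre of [joint]. Only nonnegativity is assumed, because the
    lower bound applies this to the loss of an arbitrary estimator. *)
Lemma expectation_joint (g : C -> R) : (forall z, 0 <= g z) ->
  ('E_P[fun w => g (joint w)] = \esum_(z in setT) (g z * joint_pmf z)%:E)%E.
Proof.
move=> g0; rewrite unlock.
pose F n := joint @^-1` [set z | pickle z = n].
have FT : \bigcup_n F n = setT.
  by apply/seteqP; split => // w _; exists (pickle (joint w)).
rewrite -FT ge0_integral_bigcup //=; last 4 first.
- by move=> n; exact: measurable_preimage_joint.
- rewrite FT; apply/measurable_EFinP; exact: measurable_fun_joint.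
- by move=> w _; rewrite lee_fin.
- by move=> i j _ _ [w [/= <- <-]].
pose b n : \bar R :=
  if pickle_inv n is Some z then (g z * joint_pmf z)%:E else 0%:E.
have b0 n : (0 <= b n)%E.
  rewrite /b; case: pickle_inv => // z.
  by rewrite lee_fin mulr_ge0 // ltW // joint_pmf_gt0.
transitivity (\sum_(n <oo) b n)%E.
  apply: eq_eseriesr => n _; rewrite /F preimage_joint_pickle /b.
  case: pickle_inv => [z|]; last by rewrite integral_set0.
  transitivity (\int[P]_(w in joint @^-1` [set z]) (cst (g z)%:E w))%E.
    by apply: eq_integral => w /set_mem /= ->.
  rewrite integral_cst /=; last exact: measurable_joint1.
  by rewrite [X in (_ * X)%E]joint_law -EFinM.
rewrite nneseries_esumT //.
rewrite (_ : [set: nat] = pickle @` [set: C] `|` ~` (pickle @` [set: C])); last first.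
  by rewrite setUv.
rewrite (esumID (pickle @` [set: C])) //.
rewrite setUK setIUl setICr set0U setIid [X in (_ + X)%E]esum1 ?adde0; last first.
  move=> n nC; rewrite /b; case E: pickle_inv => [z|//].
  by case: nC; exists z => //; have := @pickle_invK C n; rewrite E.
rewrite esum_image; last by move=> x y _ _; exact: (pcan_inj pickleK).
by apply: eq_esum => z _; rewrite /b pickleK_inv.
Qed.


Definition incr (o : I) (z : C) : C := [ffun i => z i + (i == o)]%N.

Lemma joint_pmf_incr o z :
  (incr o z o)%:R * joint_pmf (incr o z) = mu o * joint_pmf z.
Proof.
rewrite /joint_pmf (bigD1 o) //= [in RHS](bigD1 o) //= mulrA [RHS]mulrA.
congr (_ * _).
  rewrite ffunE eqxx addn1 /poisson_pmf mu_gt0 exprS factS natrM.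
  have : (z o)`!%:R != 0 :> R by rewrite pnatr_eq0 -lt0n fact_gt0.
  have : (z o).+1%:R != 0 :> R by rewrite pnatr_eq0.
  by move=> h1 h2; field; rewrite ?nat1r ?natr1 h1 h2.
by apply: eq_bigr => i /negbTE io; rewrite ffunE io addn0.
Qed.

Lemma incr_inj o : injective (incr o).
Proof.
move=> z z' /ffunP h; apply/ffunP => i; have := h i; rewrite !ffunE.
exact: addIn.
Qed.

Lemma incr_image o : incr o @` [set: C] = [set z | (0 < z o)%N].
Proof.
apply/seteqP; split => z /=.
  by move=> [z' _ <-]; rewrite ffunE eqxx addn1.
move=> z0; exists [ffun i => z i - (i == o)]%N => //.
by apply/ffunP => i; rewrite !ffunE; case: eqP => [->|_]; rewrite ?subnK // subn0 addn0.
Qed.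

(** Reindexing by [incr o] loses only the outcomes with [z o = 0], whose weight is zero. The
    nonnegative case comes first because integrability is itself derived from it. *)
Lemma ge0_stein o (g : C -> R) : (forall z, 0 <= g z) ->
  ('E_P[fun w => ((joint w o)%:R * g (joint w))%R] =
   'E_P[fun w => (mu o * g (incr o (joint w)))%R])%E.
Proof.
move=> g0; rewrite (@expectation_joint (fun z => (z o)%:R * g z)); last first.
  by move=> z; rewrite mulr_ge0.
rewrite (@expectation_joint (fun z => mu o * g (incr o z))); last first.
  by move=> z; rewrite mulr_ge0 // ltW.
rewrite (esumID (incr o @` [set: C])); last first.
  by move=> z _; rewrite lee_fin !mulr_ge0 // ltW // joint_pmf_gt0.
rewrite !setTI [X in (_ + X)%E]esum1 ?adde0; last first.
  move=> z; rewrite incr_image /= => /negP; rewrite lt0n negbK => /eqP ->.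
  by rewrite !mul0r.
rewrite esum_image; last by move=> x y _ _; exact: incr_inj.
apply: eq_esum => z _; congr EFin.
by rewrite mulrAC joint_pmf_incr; ring.
Qed.

(** The summand 1 makes the powers increase with the exponent, so that a single power dominates a
    polynomial in the counts. *)
Definition size1 (z : C) : R := 1 + (\sum_o z o)%:R.

Lemma size1_ge1 z : 1 <= size1 z.
Proof. by rewrite /size1 lerDl. Qed.

Lemma size1_incr o z : size1 (incr o z) = size1 z + 1.
Proof.
rewrite /size1 -addrA natr1; congr (_ + _%:R).
under eq_bigr do rewrite ffunE.
rewrite big_split /= [X in (_ + X)%N](bigD1 o) //= eqxx.
by rewrite [X in (_ + (_ + X))%N]big1 ?addn0 ?addn1 // => i /negbTE ->.
Qed.

Lemma ge0_integrable_joint (g : C -> R) : (forall z, 0 <= g z) ->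
  ('E_P[fun w => g (joint w)] < +oo)%E ->
  P.-integrable setT (fun w => (g (joint w))%:E).
Proof.
move=> g0; rewrite unlock => h; apply/integrableP; split.
  by apply/measurable_EFinP; exact: measurable_fun_joint.
by under eq_integral do rewrite gee0_abs ?lee_fin //.
Qed.

(** Induction on [n]: one factor of [size1 ^+ n.+1] is expanded into 1 and the counts, and Stein's
    identity turns a count times [size1 ^+ n] into a multiple of [(size1 + 1) ^+ n], which is at
    most [2 ^+ n * size1 ^+ n]. *)
Lemma size1_pow_integrable n :
  P.-integrable setT (fun w => (size1 (joint w) ^+ n)%:E).
Proof.
elim: n => [|n IHn].
  apply: (@eq_integrable _ _ _ _ _ measurableT (EFin \o cst 1)) => //.
  exact: finite_measure_integrable_cst.
have size1_ge0 z : 0 <= size1 z by rewrite (le_trans ler01 (size1_ge1 z)).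
have incr_int o : P.-integrable setT
    (fun w => ((joint w o)%:R * size1 (joint w) ^+ n)%:E).
  apply: (@ge0_integrable_joint (fun z => (z o)%:R * size1 z ^+ n)) => [z|].
    by rewrite mulr_ge0 ?exprn_ge0.
  rewrite (ge0_stein o (g := fun z => size1 z ^+ n)); last first.
    by move=> z; rewrite exprn_ge0.
  rewrite unlock.
  apply: (@le_lt_trans _ _
    (\int[P]_w ((mu o * 2 ^+ n) * size1 (joint w) ^+ n)%:E)%E).
    apply: ge0_le_integral => //.
    - by move=> w _; rewrite lee_fin mulr_ge0 ?exprn_ge0 // ltW.
    - apply/measurable_EFinP.
      exact: (measurable_fun_joint (fun z => mu o * size1 (incr o z) ^+ n)).
    - apply/measurable_EFinP.
      exact: (measurable_fun_joint (fun z => mu o * 2 ^+ n * size1 z ^+ n)).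
    - move=> w _; rewrite lee_fin -mulrA ler_pM2l // -exprMn lerXn2r //.
      + by rewrite nnegrE.
      + by rewrite nnegrE mulr_ge0.
      + by rewrite size1_incr; have := size1_ge1 (joint w); lra.
  by apply: integrable_lty => //; exact: (integrableZl _ (mu o * 2 ^+ n) IHn).
have -> : (fun w => (size1 (joint w) ^+ n.+1)%:E) = (fun w =>
    ((size1 (joint w) ^+ n)%:E +
     \sum_(o <- index_enum I) ((joint w o)%:R * size1 (joint w) ^+ n)%:E)%E).
  apply/funext => w; rewrite sumEFin -mulr_suml -natr_sum -EFinD.
  by congr EFin; rewrite exprS /size1 mulrDl mul1r.
by apply: integrableD => //; apply: integrable_sum.
Qed.

End poisson_family.

(** * Functions of polynomial growth and their means *)

Section poly_growth.
Context (R : realType) (I : finType).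
Local Notation C := {ffun I -> nat}.

(** A class closed under sums, products and shifts whose members are all integrable: linearity and
    Stein's identity then need only this syntactic check. *)
Definition poly_growth (g : C -> R) : Prop :=
  exists c n, 0 <= c /\ forall z, `|g z| <= c * size1 R z ^+ n.

Lemma poly_growth_cst r : poly_growth (fun _ => r).
Proof. by exists `|r|, 0%N; split => // z; rewrite expr0 mulr1. Qed.

Lemma poly_growth_coord o : poly_growth (fun z => (z o)%:R).
Proof.
exists 1, 1%N; split => // z; rewrite mul1r expr1 ger0_norm // /size1.
by rewrite (bigD1 o) //= natrD addrCA lerDl addr_ge0.
Qed.

Lemma size1_exp_le (z : C) n p : (n <= p)%N -> size1 R z ^+ n <= size1 R z ^+ p.
Proof. by move=> np; rewrite ler_weXn2l // size1_ge1. Qed.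

Lemma size1_ge0 (z : C) : 0 <= size1 R z.
Proof. exact: le_trans ler01 (size1_ge1 R z). Qed.

Lemma poly_growthD g h : poly_growth g -> poly_growth h ->
  poly_growth (fun z => g z + h z).
Proof.
move=> [c [n [c0 gc]]] [b [p [b0 hb]]]; exists (c + b), (n + p)%N.
split=> [|z]; first exact: addr_ge0.
rewrite (le_trans (ler_normD _ _)) // mulrDl lerD //.
- by rewrite (le_trans (gc z)) // ler_wpM2l // size1_exp_le ?leq_addr.
- by rewrite (le_trans (hb z)) // ler_wpM2l // size1_exp_le ?leq_addl.
Qed.

Lemma poly_growthM g h : poly_growth g -> poly_growth h ->
  poly_growth (fun z => g z * h z).
Proof.
move=> [c [n [c0 gc]]] [b [p [b0 hb]]]; exists (c * b), (n + p)%N.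
split=> [|z]; first exact: mulr_ge0.
by rewrite normrM exprD mulrACA ler_pM.
Qed.

Lemma poly_growthX g n : poly_growth g -> poly_growth (fun z => g z ^+ n).
Proof.
move=> gg; elim: n => [|n IHn].
  by under eq_fun do rewrite expr0; exact: poly_growth_cst.
by under eq_fun do rewrite exprS; exact: poly_growthM.
Qed.

Lemma poly_growthN g : poly_growth g -> poly_growth (fun z => - g z).
Proof. by move=> [c [n [c0 gc]]]; exists c, n; split=> // z; rewrite normrN. Qed.

Lemma poly_growth_sum (J : Type) (s : seq J) (g : J -> C -> R) :
  (forall j, poly_growth (g j)) -> poly_growth (fun z => \sum_(j <- s) g j z).
Proof.
move=> gg; elim: s => [|j s IHs].
  by under eq_fun do rewrite big_nil; exact: poly_growth_cst.
under eq_fun do rewrite big_cons.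
exact: poly_growthD.
Qed.

Lemma poly_growth_le g h : (forall z, `|g z| <= `|h z|) ->
  poly_growth h -> poly_growth g.
Proof.
move=> gh [c [n [c0 hc]]]; exists c, n; split=> // z.
exact: le_trans (gh z) (hc z).
Qed.

Lemma poly_growth_incr o g : poly_growth g -> poly_growth (fun z => g (incr o z)).
Proof.
move=> [c [n [c0 gc]]]; exists (c * 2 ^+ n), n.
split=> [|z]; first by rewrite mulr_ge0 // exprn_ge0.
rewrite (le_trans (gc _)) // -mulrA ler_wpM2l // -exprMn lerXn2r //.
- by rewrite nnegrE size1_ge0.
- by rewrite nnegrE mulr_ge0 // size1_ge0.
- by rewrite size1_incr; have := size1_ge1 R z; lra.
Qed.

End poly_growth.

Section mean.
Context (d : measure_display) (T : measurableType d) (R : realType).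
Context (P : probability T R) (I : finType) (Z : I -> {mfun T >-> nat}).
Context (mu : I -> R).
Hypothesis mu_gt0 : forall o, 0 < mu o.
Hypothesis indep : mutually_independent P Z.
Hypothesis law : forall o, Poisson_rv P (Z o) (mu o).
Local Notation C := {ffun I -> nat}.
Implicit Types g h : C -> R.

Definition mean g : R := \int[P]_w g (joint Z w).

Lemma poly_growth_integrable g : poly_growth g ->
  P.-integrable setT (EFin \o (fun w => g (joint Z w))).
Proof.
move=> [c [n [c0 gc]]].
have h := integrableZl measurableT c (size1_pow_integrable mu_gt0 indep law n).
apply: le_integrable h => //.
  by apply/measurable_EFinP; exact: measurable_fun_joint.
move=> w _ /=; rewrite lee_fin.
by rewrite (le_trans (gc _)) // ler_norm.
Qed.

Lemma expectation_mean g : poly_growth g ->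
  ('E_P[fun w => g (joint Z w)] = (mean g)%:E)%E.
Proof.
move=> gg; rewrite unlock /mean /Rintegral fineK //.
exact: integrable_fin_num (poly_growth_integrable gg).
Qed.

Lemma mean_cst r : mean (fun _ => r) = r.
Proof. by have := expectation_cst P r; rewrite unlock /mean /Rintegral => ->. Qed.

Lemma meanD g h : poly_growth g -> poly_growth h ->
  mean (fun z => g z + h z) = mean g + mean h.
Proof. by move=> gg gh; apply: RintegralD => //; exact: poly_growth_integrable. Qed.

Lemma meanZ r g : poly_growth g -> mean (fun z => r * g z) = r * mean g.
Proof. by move=> gg; apply: RintegralZl => //; exact: poly_growth_integrable. Qed.

Lemma mean_le g h : poly_growth g -> poly_growth h ->
  (forall z, g z <= h z) -> mean g <= mean h.
Proof.
by move=> gg hh gh; apply: le_Rintegral => //; exact: poly_growth_integrable.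
Qed.

Lemma mean_sum (J : Type) (s : seq J) (g : J -> C -> R) :
  (forall j, poly_growth (g j)) ->
  mean (fun z => \sum_(j <- s) g j z) = \sum_(j <- s) mean (g j).
Proof.
move=> gg; elim: s => [|j s IHs].
  by under [X in mean X]eq_fun do rewrite big_nil; rewrite mean_cst big_nil.
under [X in mean X]eq_fun do rewrite big_cons.
rewrite meanD ?IHs ?big_cons //.
exact: poly_growth_sum.
Qed.

(** With [h = c * size1 ^+ n] dominating the absolute value of [g], both [g + h] and [h] are
    nonnegative; the identity for [g] is the difference of theirs. *)
Lemma mean_stein o g : poly_growth g ->
  mean (fun z => (z o)%:R * g z) = mu o * mean (fun z => g (incr o z)).
Proof.
have ge0 h : poly_growth h -> (forall z, 0 <= h z) ->
    mean (fun z => (z o)%:R * h z) = mu o * mean (fun z => h (incr o z)).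
  move=> gh h0; rewrite -meanZ; last exact: poly_growth_incr.
  by rewrite /mean /Rintegral; have := ge0_stein mu_gt0 indep law o h0; rewrite unlock => ->.
move=> gg; have [c [n [c0 gc]]] := gg.
pose h (z : C) : R := c * size1 R z ^+ n.
have gh : poly_growth h.
  exists c, n; split => // z.
  by rewrite ger0_norm // mulr_ge0 // exprn_ge0 // size1_ge0.
have h0 z : 0 <= h z by rewrite mulr_ge0 // exprn_ge0 // size1_ge0.
have gz := poly_growth_coord R o.
have := ge0 _ (poly_growthD gg gh).
have -> : mean (fun z => (z o)%:R * (g z + h z)) =
    mean (fun z => (z o)%:R * g z) + mean (fun z => (z o)%:R * h z).
  by rewrite -meanD; [congr mean; apply/funext => z; rewrite mulrDr|
    exact: poly_growthM|exact: poly_growthM].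
rewrite meanD; [|exact: poly_growth_incr|exact: poly_growth_incr].
rewrite (ge0 h) // mulrDr => H; apply/(addIr (mu o * mean (fun z => h (incr o z))))/H.
by move=> z; have := gc z; rewrite -/(h z) ler_norml => /andP[]; lra.
Qed.

End mean.

(** * Risks of the estimators *)

Section statistics.
Context (R : realType) (m : nat).
Local Notation C := {ffun option 'I_m -> nat}.

Definition sumX (z : C) : nat := (\sum_i z (Some i))%N.

Lemma sumX_incrX i z : sumX (incr (Some i) z) = (sumX z).+1.
Proof.
rewrite /sumX (bigD1 i) //= [in RHS](bigD1 i) //= ffunE eqxx addn1 addSn.
congr (_ + _).+1; apply: eq_bigr => j /negbTE ji; rewrite ffunE.
by rewrite (_ : (_ == _) = false) ?addn0 // -ji.
Qed.

Lemma sumX_incrY z : sumX (incr None z) = sumX z.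
Proof. by apply: eq_bigr => j _; rewrite ffunE addn0. Qed.

Definition sy_growth (f : nat -> nat -> R) : Prop :=
  poly_growth (fun z : C => f (sumX z) (z None)).

Lemma sy_growth_cst r : sy_growth (fun _ _ => r).
Proof. exact: poly_growth_cst. Qed.

Lemma sy_growth_s : sy_growth (fun s _ => s%:R).
Proof.
rewrite /sy_growth /sumX.
under eq_fun do rewrite natr_sum.
apply: poly_growth_sum => i; exact: poly_growth_coord.
Qed.

Lemma sy_growth_y : sy_growth (fun _ y => y%:R).
Proof. exact: poly_growth_coord. Qed.

Lemma sy_growth_bounded (w : nat -> R) : (forall s, `|w s| <= 1) ->
  sy_growth (fun s _ => w s).
Proof.
move=> w1; apply: (@poly_growth_le _ _ _ (fun _ => 1)); last exact: poly_growth_cst.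
by move=> z; rewrite normr1.
Qed.

Lemma sy_growthD f g : sy_growth f -> sy_growth g ->
  sy_growth (fun s y => f s y + g s y).
Proof. exact: poly_growthD. Qed.

Lemma sy_growthM f g : sy_growth f -> sy_growth g ->
  sy_growth (fun s y => f s y * g s y).
Proof. exact: poly_growthM. Qed.

Lemma sy_growthN f : sy_growth f -> sy_growth (fun s y => - f s y).
Proof. exact: poly_growthN. Qed.

Lemma sy_growthX f n : sy_growth f -> sy_growth (fun s y => f s y ^+ n).
Proof. exact: poly_growthX. Qed.

End statistics.

Ltac sy_growth :=
  repeat first [assumption | apply: sy_growth_cst | apply: sy_growth_s
    | apply: sy_growth_y | apply: sy_growthD | apply: sy_growthN
    | apply: sy_growthX | apply: sy_growthM].

(** * Means of functions of S and Y, and the risk of c(S, Y) X *)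

Section model.
Context (d : measure_display) (T : measurableType d) (R : realType) (m : nat).
Context (P : 'rV[R]_m -> probability T R).
Context (X : 'I_m -> {mfun T >-> nat}) (Y : {mfun T >-> nat}).
Hypothesis model : Poisson_model P X Y.
Hypothesis m_gt0 : (0 < m)%N.
Context (l : 'rV[R]_m) (l_pos : pos_param l).
Local Notation C := {ffun option 'I_m -> nat}.

Definition XY (o : option 'I_m) := if o is Some i then X i else Y.
Definition rate (o : option 'I_m) : R := if o is Some i then l 0 i else \sum_i l 0 i.
Local Notation Lam := (\sum_i l 0 i).
Local Notation kap := (m%:R - 1 : R).

Lemma Lam_gt0 : 0 < Lam.
Proof.
case: m m_gt0 l l_pos => // n _ l' h.
rewrite (bigD1 ord0) //= ltr_pwDl //.
by apply: sumr_ge0 => i _; exact/ltW/h.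
Qed.

Lemma rate_gt0 o : 0 < rate o.
Proof. by case: o => [i|]; [exact: l_pos|exact: Lam_gt0]. Qed.

Lemma XY_indep : mutually_independent (P l) XY.
Proof. by have [] := model l_pos. Qed.

Lemma XY_law o : Poisson_rv (P l) (XY o) (rate o).
Proof. by have [_ h1 h2] := model l_pos; case: o. Qed.

Local Notation E := (mean (P l) XY).
Let E_stein := mean_stein rate_gt0 XY_indep XY_law.
Let ED := meanD rate_gt0 XY_indep XY_law.
Let EZ := meanZ rate_gt0 XY_indep XY_law.

Definition mean_sy (f : nat -> nat -> R) : R := E (fun z => f (sumX z) (z None)).

Local Notation sy_growth := (@sy_growth R m).

Lemma eq_mean_sy f g : (forall s y, f s y = g s y) -> mean_sy f = mean_sy g.
Proof. by move=> fg; congr mean; apply/funext => z; rewrite fg. Qed.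

Lemma mean_sy_cst r : mean_sy (fun _ _ => r) = r.
Proof. exact: mean_cst. Qed.

Lemma mean_syD f g : sy_growth f -> sy_growth g ->
  mean_sy (fun s y => f s y + g s y) = mean_sy f + mean_sy g.
Proof. exact: ED. Qed.

Lemma mean_syZ r f : sy_growth f ->
  mean_sy (fun s y => r * f s y) = r * mean_sy f.
Proof. exact: EZ. Qed.

Lemma mean_sy_le f g : sy_growth f -> sy_growth g ->
  (forall s y, f s y <= g s y) -> mean_sy f <= mean_sy g.
Proof. by move=> ff gg fg; apply: (mean_le rate_gt0 XY_indep XY_law) => // z. Qed.

Lemma sum_coordX (z : C) : \sum_i (z (Some i))%:R = (sumX z)%:R :> R.
Proof. by rewrite /sumX natr_sum. Qed.

(** The identities of the coordinates are added up: raising any X_i by one raises S by one. The law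
    of S is thus never computed. *)
Lemma mean_sy_steinS f : sy_growth f ->
  mean_sy (fun s y => s%:R * f s y) = Lam * mean_sy (fun s y => f s.+1 y).
Proof.
move=> gf; rewrite /mean_sy mulr_suml.
transitivity (E (fun z => \sum_i (z (Some i))%:R * f (sumX z) (z None))).
  by congr mean; apply/funext => z; rewrite -mulr_suml sum_coordX.
rewrite (mean_sum rate_gt0 XY_indep XY_law); last first.
  by move=> i; apply: poly_growthM => //; exact: poly_growth_coord.
apply: eq_bigr => i _; rewrite E_stein //; congr (_ * mean _ _ _).
by apply/funext => z; rewrite sumX_incrX ffunE addn0.
Qed.

Lemma mean_sy_steinY f : sy_growth f ->
  mean_sy (fun s y => y%:R * f s y) = Lam * mean_sy (fun s y => f s y.+1).
Proof.
move=> gf; rewrite /mean_sy E_stein //; congr (_ * mean _ _ _).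
by apply/funext => z; rewrite sumX_incrY ffunE eqxx addn1.
Qed.

(** Y is integrated out with S held fixed, its first two moments being Lam and Lam^2 + Lam. *)
Lemma mean_sy_quad (a b c : nat -> R) : sy_growth (fun s _ => a s) ->
  sy_growth (fun s _ => b s) -> sy_growth (fun s _ => c s) ->
  mean_sy (fun s y => a s + b s * y%:R + c s * y%:R ^+ 2) =
  mean_sy (fun s _ => a s + b s * Lam + c s * (Lam ^+ 2 + Lam)).
Proof.
move=> ga gb gc.
have h1 g : sy_growth (fun s _ => g s) ->
    mean_sy (fun s y => g s * y%:R) = Lam * mean_sy (fun s _ => g s).
  move=> gg; rewrite -(mean_sy_steinY gg); apply: eq_mean_sy => s y.
  by rewrite mulrC.
have gy := sy_growth_y R m.
have h2 : mean_sy (fun s y => c s * y%:R ^+ 2) =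
    (Lam ^+ 2 + Lam) * mean_sy (fun s _ => c s).
  transitivity (mean_sy (fun s y => y%:R * (c s * y%:R))).
    by apply: eq_mean_sy => s y; ring.
  rewrite mean_sy_steinY; last by sy_growth.
  transitivity (Lam * mean_sy (fun s y => c s * y%:R + c s)).
    by congr (_ * _); apply: eq_mean_sy => s y; rewrite -natr1; ring.
  by rewrite mean_syD; [rewrite h1 //; ring|sy_growth|sy_growth].
have e1 : mean_sy (fun s _ => b s * Lam) = Lam * mean_sy (fun s _ => b s).
  by rewrite -mean_syZ //; apply: eq_mean_sy => s y; rewrite mulrC.
have e2 : mean_sy (fun s _ => c s * (Lam ^+ 2 + Lam)) =
    (Lam ^+ 2 + Lam) * mean_sy (fun s _ => c s).
  by rewrite -mean_syZ //; apply: eq_mean_sy => s y; rewrite mulrC.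
rewrite mean_syD; [|sy_growth|sy_growth].
rewrite mean_syD; [|sy_growth|sy_growth].
rewrite mean_syD; [|sy_growth|sy_growth].
rewrite mean_syD; [|sy_growth|sy_growth].
by rewrite h1 // h2 e1 e2.
Qed.

(** S is integrated out as well, except in [w], which will be 1 / (S + k) or the indicator of S =
    0. *)
Lemma mean_sy_lin a0 a1 a2 b (w : nat -> R) : sy_growth (fun s _ => w s) ->
  mean_sy (fun s _ => a0 + a1 * s%:R + a2 * s%:R ^+ 2 + b * w s) =
  a0 + a1 * Lam + a2 * (Lam ^+ 2 + Lam) + b * mean_sy (fun s _ => w s).
Proof.
move=> gw; have gs := sy_growth_s R m.
have h1 : mean_sy (fun s y => s%:R) = Lam.
  transitivity (mean_sy (fun s _ => s%:R * 1)).
    by apply: eq_mean_sy => s y; rewrite mulr1.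
  by rewrite mean_sy_steinS; [rewrite mean_sy_cst mulr1|sy_growth].
have h2 : mean_sy (fun s y => s%:R ^+ 2) = Lam ^+ 2 + Lam.
  rewrite (@mean_sy_steinS (fun s _ => s%:R)) //.
  transitivity (Lam * mean_sy (fun s _ => s%:R + 1)).
    by congr (_ * _); apply: eq_mean_sy => s y; rewrite natr1.
  by rewrite mean_syD; [rewrite h1 mean_sy_cst; ring|sy_growth|sy_growth].
rewrite mean_syD; [|sy_growth|sy_growth].
rewrite mean_syD; [|sy_growth|sy_growth].
rewrite mean_syD; [|sy_growth|sy_growth].
rewrite !mean_syZ ?h1 ?h2 ?mean_sy_cst //; sy_growth.
Qed.

Lemma risk_sy (est : estimator R m) (f : nat -> nat -> R) :
  (forall x y, loss (est x y) l = f (\sum_i x 0%R i)%N y) -> sy_growth f ->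
  risk P X Y est l = (mean_sy f)%:E.
Proof.
move=> lossE gf; rewrite -(expectation_mean rate_gt0 XY_indep XY_law gf) /risk.
congr expectation; apply/funext => w; rewrite lossE ffunE.
by congr f; apply: eq_bigr => i _; rewrite mxE ffunE.
Qed.

(* Conditionally on its sum [s] and on [Y], [X] is multinomial; Stein's identity
   coordinatewise replaces that conditioning. *)
Lemma risk_scaled (est : estimator R m) (c : nat -> nat -> R) :
  (forall x y, est x y = c (\sum_i x 0%R i)%N y *: vec R x) -> sy_growth c ->
  risk P X Y est l =
  (mean_sy (fun s y =>
    ((s%:R * c s y - Lam) ^+ 2 + kap * s%:R * c s y ^+ 2) / Lam))%:E.
Proof.
move=> estE gc.
have gs := sy_growth_s R m.
pose L (z : C) := loss (est (\row_i z (Some i)) (z None)) l.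
pose q i (z : C) :=
  (z (Some i))%:R * (c (sumX z) (z None) ^+ 2 * (z (Some i))%:R / l 0 i).
have LE z : L z = \sum_i q i z +
    (- 2 * ((sumX z)%:R * c (sumX z) (z None)) + Lam).
  rewrite /L /loss estE /vec.
  have -> : (\sum_i (\row_i0 z (Some i0)) 0%R i)%N = sumX z.
    by apply: eq_bigr => i _; rewrite mxE.
  rewrite -sum_coordX mulr_suml mulr_sumr -!big_split /=.
  apply: eq_bigr => i _; rewrite !mxE /q.
  by field; rewrite gt_eqF.
have gcz : poly_growth (fun z : C => c (sumX z) (z None)) by [].
have gq i : poly_growth (q i).
  rewrite /q; apply: poly_growthM; first exact: poly_growth_coord.
  apply: poly_growthM; last exact: poly_growth_cst.
  by apply: poly_growthM; [exact: poly_growthX|exact: poly_growth_coord].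
have gsum : poly_growth (fun z => \sum_i q i z) by exact: poly_growth_sum.
have gr : sy_growth (fun s y => - 2 * (s%:R * c s y) + Lam) by sy_growth.
have gL : poly_growth L.
  rewrite (funext LE).
  exact: poly_growthD.
have -> : risk P X Y est l = (E L)%:E.
  rewrite -(expectation_mean rate_gt0 XY_indep XY_law gL) /risk.
  congr expectation; apply/funext => w; rewrite /L.
  rewrite (_ : \row_i joint XY w (Some i) = \row_i X i w) ?ffunE //.
  by apply/rowP => i; rewrite !mxE ffunE.
congr EFin.
transitivity (E (fun z => \sum_i q i z) +
    mean_sy (fun s y => - 2 * (s%:R * c s y) + Lam)).
  by rewrite -ED //; congr mean; apply/funext => z; exact: LE.
(* Stein's identity cancels the division by [l 0 i]; the sum of x_i + 1 over the m coordinates is s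
   + m, that is [s.+1 + kap]. *)
have -> : E (fun z => \sum_i q i z) =
    mean_sy (fun s y => c s.+1 y ^+ 2 * (s.+1%:R + kap)).
  rewrite (mean_sum rate_gt0 XY_indep XY_law) //.
  transitivity (\sum_i E (fun z =>
      c (sumX z).+1 (z None) ^+ 2 * ((z (Some i))%:R + 1))).
    apply: eq_bigr => i _; rewrite E_stein; last first.
      apply: poly_growthM; last exact: poly_growth_cst.
      by apply: poly_growthM; [exact: poly_growthX|exact: poly_growth_coord].
    rewrite -EZ; last first.
      apply: (@poly_growth_incr _ _ (Some i)
        (fun z => c (sumX z) (z None) ^+ 2 * (z (Some i))%:R / l 0 i)).
      apply: poly_growthM; last exact: poly_growth_cst.
      by apply: poly_growthM; [exact: poly_growthX|exact: poly_growth_coord].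
    congr mean; apply/funext => z; rewrite /= sumX_incrX !ffunE eqxx /= addn0 addn1.
    by rewrite -natr1; field; rewrite gt_eqF.
  rewrite -(mean_sum rate_gt0 XY_indep XY_law); last first.
    move=> i; apply: poly_growthM.
      apply: poly_growthX.
      have := poly_growth_incr (Some i) gcz.
      by congr poly_growth; apply/funext => z; rewrite sumX_incrX ffunE addn0.
    by apply: poly_growthD; [exact: poly_growth_coord|exact: poly_growth_cst].
  congr mean; apply/funext => z.
  rewrite -mulr_sumr big_split /= sum_coordX; congr (_ * _).
  by rewrite sumr_const card_ord -natr1; ring.
have L0 : Lam != 0 by rewrite gt_eqF // Lam_gt0.
(* Stein's identity for S, read backwards, restores [c s y] at the price of a division by Lam. *)
have -> : mean_sy (fun s y => c s.+1 y ^+ 2 * (s.+1%:R + kap)) =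
   mean_sy (fun s y => Lam^-1 * (s%:R * (c s y ^+ 2 * (s%:R + kap)))).
  rewrite mean_syZ; last by sy_growth.
  rewrite (@mean_sy_steinS (fun s y => c s y ^+ 2 * (s%:R + kap))).
    by rewrite mulKf.
  by sy_growth.
rewrite -mean_syD; [|sy_growth|sy_growth].
by apply: eq_mean_sy => s y; field.
Qed.

End model.

Section estimator_risks.
Context (d : measure_display) (T : measurableType d) (R : realType) (m : nat).
Context (P : 'rV[R]_m -> probability T R).
Context (X : 'I_m -> {mfun T >-> nat}) (Y : {mfun T >-> nat}).
Hypothesis model : Poisson_model P X Y.
Hypothesis m_gt0 : (0 < m)%N.
Local Notation kap := (m%:R - 1 : R).
Local Notation sy_growth := (@sy_growth R m).
Local Notation w s := ((s%:R + kap)^-1).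

Lemma kap_natE (s : nat) : s%:R + kap = (s + m.-1)%:R.
Proof. by rewrite natrD -subn1 natrB. Qed.

Lemma inv_nat_le1 (n : nat) : `|n%:R^-1 : R| <= 1.
Proof.
case: n => [|n]; first by rewrite invr0 normr0.
by rewrite ger0_norm ?invr_ge0 // invf_le1 ?ler1n ?ltr0n.
Qed.

Lemma kap_ge0 : 0 <= kap.
Proof. by rewrite subr_ge0 ler1n. Qed.

Lemma w_le1 s : `|w s| <= 1.
Proof. rewrite kap_natE; exact: inv_nat_le1. Qed.

Lemma add_kap_neq0 s : (2 <= m)%N -> s%:R + kap != 0.
Proof.
move=> m2; rewrite kap_natE pnatr_eq0 -lt0n addn_gt0.
by case: m m2 => [|[|p]] //= _; rewrite orbT.
Qed.

Let gw : sy_growth (fun s _ => w s) := sy_growth_bounded m w_le1.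

Section fixed_parameter.
Context (l : 'rV[R]_m) (l_pos : pos_param l).
Local Notation Lam := (\sum_i l 0 i).
Local Notation mean_sy := (@mean_sy _ _ _ _ P X Y l).

Let Lam0 : 0 < Lam := Lam_gt0 m_gt0 l_pos.
Let Lam_neq0 : Lam != 0 := lt0r_neq0 Lam0.

Lemma mean_w_ge0 : 0 <= mean_sy (fun s _ => w s).
Proof.
rewrite -(mean_sy_cst P X Y l 0); apply: (mean_sy_le model) => //.
  exact: sy_growth_cst.
by move=> s _; rewrite kap_natE invr_ge0.
Qed.

(* Stein's identity for [f s = 1 / (s + m - 2)], for which [s * f s <= 1] and
   [f s.+1 = 1 / (s + m - 1)]. *)
Lemma mean_w_le : (2 <= m)%N -> Lam * mean_sy (fun s _ => w s) <= 1.
Proof.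
move=> m2.
have kE n : n%:R + kap - 1 = (n + m.-2)%:R.
  by rewrite kap_natE; case: m m2 => [|[|p]] //= _; rewrite addnS -natr1 addrK.
have gf : sy_growth (fun s _ => (s%:R + kap - 1)^-1).
  by apply: sy_growth_bounded => s; rewrite kE; exact: inv_nat_le1.
have := mean_sy_steinS model m_gt0 l_pos gf.
rewrite (eq_mean_sy P X Y l (f := fun s _ => (s.+1%:R + kap - 1)^-1)
  (g := fun s _ => w s)); last by move=> s _; rewrite -natr1; congr (_^-1); ring.
move=> <-; rewrite -[leRHS](mean_sy_cst P X Y l 1).
apply: (mean_sy_le model) => //.
- by apply: sy_growthM => //; exact: sy_growth_s.
- exact: sy_growth_cst.
move=> s _; rewrite kE; case: (posnP s) => [->|s0]; first by rewrite mul0r.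
by rewrite ler_pdivrMr ?mul1r ?ler_nat ?leq_addr // ltr0n addn_gt0 s0.
Qed.

(** Here (s c)^2 + k s c^2 = s (s + k) c^2, and s / (s + k) = 1 - k / (s + k), so the risk is
    explicit up to e = E[1 / (S + k)]: it equals 1/2 + k/4 + k (3 Lam e - e) / 4, and e >= 0 and Lam
    e <= 1 conclude. *)
Lemma risk_est_O_XY_le : (2 <= m)%N ->
  (risk P X Y (est_O_XY R m) l <= (m%:R - 2^-1)%:E)%E.
Proof.
move=> m2.
have gs := sy_growth_s R m; have gy := sy_growth_y R m.
pose c s y := (s%:R + y%:R + kap) / 2 * w s.
have gc : sy_growth c by rewrite /c; sy_growth.
rewrite (risk_scaled model m_gt0 l_pos (c := c)) //; last first.
  by move=> x y; rewrite /est_O_XY /Defs.total -natr_sum scalerA /c !addrA.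
have sw s := add_kap_neq0 s m2.
rewrite (eq_mean_sy P X Y l (g := fun s y =>
  (s%:R ^+ 2 / (4 * Lam) + s%:R * kap / (4 * Lam) - s%:R + Lam) +
  (s%:R / (2 * Lam) - 1 + kap * w s) * y%:R +
  ((1 - kap * w s) / (4 * Lam)) * y%:R ^+ 2)); last first.
  by move=> s y; rewrite /c; field; rewrite Lam_neq0 sw.
rewrite (mean_sy_quad model m_gt0 l_pos); [|sy_growth|sy_growth|sy_growth].
rewrite (eq_mean_sy P X Y l (g := fun s y =>
  (Lam + 1) / 4 + (kap / (4 * Lam) - 2^-1) * s%:R + (4 * Lam)^-1 * s%:R ^+ 2 +
  kap * (3 * Lam - 1) / 4 * w s)); last first.
  by move=> s y; field; rewrite Lam_neq0 sw.
rewrite (mean_sy_lin model m_gt0 l_pos) // lee_fin.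
have := mean_w_le m2; have := mean_w_ge0; have := kap_ge0.
set e := mean_sy _ => k0 e0 e1.
have -> : (Lam + 1) / 4 + (kap / (4 * Lam) - 2^-1) * Lam +
    (4 * Lam)^-1 * (Lam ^+ 2 + Lam) + kap * (3 * Lam - 1) / 4 * e =
    2^-1 + kap / 4 + kap * (3 * (Lam * e) - e) / 4 by field.
have : kap * (3 * (Lam * e) - e) <= kap * 3 by apply: ler_wpM2l => //; lra.
lra.
Qed.

Lemma risk_est_XY_le : (2 <= m)%N ->
  (risk P X Y (est_XY R m) l <= (m%:R - 2^-1)%:E)%E.
Proof.
move=> m2.
have gs := sy_growth_s R m; have gy := sy_growth_y R m.
pose c s y := (s%:R + y%:R) / 2 * w s.
have gc : sy_growth c by rewrite /c; sy_growth.
rewrite (risk_scaled model m_gt0 l_pos (c := c)) //; last first.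
  by move=> x y; rewrite /est_XY /Defs.total -natr_sum scalerA /c !addrA.
have sw s := add_kap_neq0 s m2.
(* With t = (s + y) / 2 the integrand is s w (t - Lam)^2 / Lam + k Lam w; [g] replaces the factor s
   w, which is at most 1, by 1. *)
pose g s y := ((s%:R / 2 - Lam) ^+ 2 / Lam + kap * Lam * w s) +
  ((s%:R / 2 - Lam) / Lam) * y%:R + (4 * Lam)^-1 * y%:R ^+ 2.
have gg : sy_growth g by rewrite /g; sy_growth.
have : mean_sy g <= m%:R - 2^-1.
  rewrite /g (mean_sy_quad model m_gt0 l_pos); [|sy_growth|sy_growth|sy_growth].
  rewrite (eq_mean_sy P X Y l (g := fun s y =>
    (Lam + 1) / 4 + (- 2^-1) * s%:R + (4 * Lam)^-1 * s%:R ^+ 2 +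
    kap * Lam * w s)); last first.
    by move=> s y; field; rewrite Lam_neq0 sw.
  rewrite (mean_sy_lin model m_gt0 l_pos) //.
  have := mean_w_le m2; have := kap_ge0.
  set e := mean_sy _ => k0 e1.
  have -> : (Lam + 1) / 4 + - 2^-1 * Lam +
      (4 * Lam)^-1 * (Lam ^+ 2 + Lam) + kap * Lam * e =
      2^-1 + kap * (Lam * e) by field.
  have : kap * (Lam * e) <= kap * 1 by apply: ler_wpM2l.
  lra.
rewrite lee_fin; apply: le_trans; apply: (mean_sy_le model) => //.
  by rewrite /c; sy_growth.
move=> s y; rewrite -subr_ge0.
have -> : g s y - ((s%:R * c s y - Lam) ^+ 2 + kap * s%:R * c s y ^+ 2) / Lam =
    kap * w s / Lam * ((s%:R + y%:R) / 2 - Lam) ^+ 2.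
  by rewrite /g /c; field; rewrite Lam_neq0 sw.
rewrite mulr_ge0 ?sqr_ge0 // divr_ge0 ?(ltW Lam0) // mulr_ge0 ?kap_ge0 //.
by rewrite kap_natE invr_ge0.
Qed.

(** The outcome with all counts zero has positive probability. This is the source of the strict
    inequality for [est_ML]. *)
Lemma mean_no_count_gt0 : 0 < mean_sy (fun s _ => (s == 0%N)%:R).
Proof.
have g1 : sy_growth (fun s _ => (s == 0%N)%:R).
  by apply: sy_growth_bounded => s; case: eqP => _; rewrite ?normr1 ?normr0.
have mu0 := rate_gt0 m_gt0 l_pos.
have ind := XY_indep model l_pos; have law := XY_law model l_pos.
rewrite -lte_fin -(expectation_mean mu0 ind law g1).
rewrite (expectation_joint mu0 ind law (g := fun z => (sumX z == 0%N)%:R)) //.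
pose z0 : {ffun option 'I_m -> nat} := [ffun=> 0%N].
apply: (@lt_le_trans _ _ (joint_pmf (rate l) z0)%:E).
  by rewrite lte_fin joint_pmf_gt0.
apply: esum_ge; exists [set z0]; first by split.
rewrite fsbig_set1 /sumX big1 ?eqxx ?mul1r // => i _; by rewrite ffunE.
Qed.

(* Drops [kap / (4 * s) * (s - y) ^+ 2 / Lam] from the risk when [s != 0]: what is
   left is quadratic in [s] and [y] up to a correction at [s = 0], where [est_ML]
   is [0]. *)
Lemma risk_est_ML_gt : 3 * Lam > 4 * m%:R - 3 ->
  ((m%:R - 2^-1)%:E < risk P X Y (est_ML R m) l)%E.
Proof.
move=> Lam_big.
have gs := sy_growth_s R m; have gy := sy_growth_y R m.
pose c (s y : nat) : R := (s%:R + y%:R) / 2 * s%:R^-1.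
have gi : sy_growth (fun s _ => s%:R^-1) by exact: sy_growth_bounded inv_nat_le1.
have gc : sy_growth c by rewrite /c; sy_growth.
rewrite (risk_scaled model m_gt0 l_pos (c := c)) //; last first.
  by move=> x y; rewrite /est_ML /Defs.total -natr_sum scalerA.
pose u (s : nat) : R := (s == 0%N)%:R.
have gu : sy_growth (fun s _ => u s).
  by apply: sy_growth_bounded => s; rewrite /u; case: eqP => _; rewrite ?normr1 ?normr0.
pose g s y := (s%:R / 2 - Lam) ^+ 2 / Lam +
  ((s%:R / 2 - Lam + kap + u s * (Lam - kap)) / Lam) * y%:R +
  ((1 - u s) / (4 * Lam)) * y%:R ^+ 2.
have gg : sy_growth g by rewrite /g; sy_growth.
have : m%:R - 2^-1 < mean_sy g.
  rewrite /g (mean_sy_quad model m_gt0 l_pos); [|sy_growth|sy_growth|sy_growth].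
  rewrite (eq_mean_sy P X Y l (g := fun s y =>
    kap + (Lam + 1) / 4 + (- 2^-1) * s%:R + (4 * Lam)^-1 * s%:R ^+ 2 +
    (3 * Lam / 4 - 4^-1 - kap) * u s)); last first.
    by move=> s y; field; rewrite Lam_neq0.
  rewrite (mean_sy_lin model m_gt0 l_pos) //.
  have := mean_no_count_gt0; rewrite -/(mean_sy (fun s _ => u s)).
  set e := mean_sy _ => e0.
  have -> : kap + (Lam + 1) / 4 + - 2^-1 * Lam +
      (4 * Lam)^-1 * (Lam ^+ 2 + Lam) + (3 * Lam / 4 - 4^-1 - kap) * e =
      kap + 2^-1 + (3 * Lam / 4 - 4^-1 - kap) * e by field.
  (* The hypothesis on Lam says exactly that this coefficient is positive. *)
  have : 0 < (3 * Lam / 4 - 4^-1 - kap) * e by apply: mulr_gt0 => //; lra.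
  lra.
rewrite lte_fin => /lt_le_trans; apply; apply: (mean_sy_le model) => //.
  by rewrite /c; sy_growth.
move=> s y; rewrite -subr_ge0 /g /c /u.
case: eqP => [->|/eqP s0] /=.
  (* At s = 0 the estimate is 0, and both integrands equal Lam. *)
  by rewrite invr0 le_eqVlt; apply/orP; left; apply/eqP; field.
have s1 : 0 < s%:R :> R by rewrite ltr0n lt0n.
have -> : ((s%:R * ((s%:R + y%:R) / 2 / s%:R) - Lam) ^+ 2 +
    kap * s%:R * ((s%:R + y%:R) / 2 / s%:R) ^+ 2) / Lam -
    ((s%:R / 2 - Lam) ^+ 2 / Lam +
    (s%:R / 2 - Lam + kap + 0 * (Lam - kap)) / Lam * y%:R +
    (1 - 0) / (4 * Lam) * y%:R ^+ 2) =
    kap / (4 * s%:R * Lam) * (s%:R - y%:R) ^+ 2.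
  by field; rewrite Lam_neq0 gt_eqF.
rewrite mulr_ge0 ?sqr_ge0 // divr_ge0 ?kap_ge0 //.
by rewrite !mulr_ge0 // ltW.
Qed.

Lemma risk_est_O_X : risk P X Y (est_O_X R m) l = m%:R%:E.
Proof.
have gs := sy_growth_s R m.
rewrite (risk_scaled model m_gt0 l_pos (c := fun _ _ => 1)) //; first last.
- exact: sy_growth_cst.
- by move=> x y; rewrite scale1r.
rewrite (eq_mean_sy P X Y l (g := fun s y =>
    Lam + (kap / Lam - 2) * s%:R + Lam^-1 * s%:R ^+ 2 + 0 * 0)); last first.
  by move=> s y; field.
rewrite (@mean_sy_lin _ _ _ _ _ _ _ model m_gt0 _ l_pos _ _ _ _ (fun=> 0)).
  by congr EFin; field.
exact: sy_growth_cst.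
Qed.

(** Since Lam E[1 / (S + k)] <= 1, the risk is at least m - k^2 / Lam - k^3 / Lam^2. The choice of
    Lam makes the two subtracted terms 1/4 and 1 / (16 k), whose sum is below 1/2. *)
Lemma risk_est_X_gt : (2 <= m)%N -> Lam = 4 * kap ^+ 2 ->
  ((m%:R - 2^-1)%:E < risk P X Y (est_X R m) l)%E.
Proof.
move=> m2 LamE.
have gs := sy_growth_s R m.
pose c s (y : nat) := s%:R * w s.
have gc : sy_growth c by rewrite /c; sy_growth.
rewrite (risk_scaled model m_gt0 l_pos (c := c)) //; last first.
  by move=> x y; rewrite /est_X /Defs.total -natr_sum scalerA /c !addrA.
have sw s := add_kap_neq0 s m2.
rewrite (eq_mean_sy P X Y l (g := fun s y =>
  (kap ^+ 2 / Lam + 2 * kap + Lam) + (- kap / Lam - 2) * s%:R +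
  Lam^-1 * s%:R ^+ 2 + (- (kap ^+ 3 / Lam + 2 * kap ^+ 2)) * w s)); last first.
  by move=> s y; rewrite /c; field; rewrite Lam_neq0 sw.
rewrite (mean_sy_lin model m_gt0 l_pos) // lte_fin.
have k1 : 1 <= kap by rewrite lerBrDr -[1 + 1]/(2%:R) ler_nat.
have := mean_w_le m2.
set e := mean_sy _ => e1.
have -> : kap ^+ 2 / Lam + 2 * kap + Lam + (- kap / Lam - 2) * Lam +
    Lam^-1 * (Lam ^+ 2 + Lam) + - (kap ^+ 3 / Lam + 2 * kap ^+ 2) * e =
    kap + 1 + kap ^+ 2 / Lam - (kap ^+ 3 / Lam ^+ 2 + 2 * kap ^+ 2 / Lam) * (Lam * e).
  by field.
have k0 : kap != 0 by rewrite gt_eqF //; lra.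
have E1 : kap ^+ 2 / Lam = 4^-1 by rewrite LamE; field.
have E2 : kap ^+ 3 / Lam ^+ 2 = 16^-1 * kap^-1 by rewrite LamE; field.
rewrite -mulrA E1 E2.
have ki : 0 < kap^-1 <= 1.
  by rewrite invr_gt0 invf_le1 ?(lt_le_trans ltr01 k1).
have : (16^-1 * kap^-1 + 2 * 4^-1) * (Lam * e) <= (16^-1 * kap^-1 + 2 * 4^-1) * 1.
  by apply: ler_wpM2l => //; lra.
lra.
Qed.

Lemma risk_est_mean : m = 1%N -> risk P X Y (est_mean R m) l = 2^-1%:E.
Proof.
move=> m1.
have gs := sy_growth_s R m; have gy := sy_growth_y R m.
rewrite (risk_sy model m_gt0 l_pos
  (f := fun s y => ((s%:R + y%:R) / 2 - Lam) ^+ 2 / Lam)); first last.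
- by sy_growth.
- by move=> x y; rewrite /loss /est_mean; move: (l) (x); rewrite m1 => l' x';
    rewrite !big_ord1 mxE.
rewrite (eq_mean_sy P X Y l (g := fun s y => (s%:R / 2 - Lam) ^+ 2 / Lam +
  ((s%:R / 2 - Lam) / Lam) * y%:R + (4 * Lam)^-1 * y%:R ^+ 2)); last first.
  by move=> s y; field.
rewrite (mean_sy_quad model m_gt0 l_pos); [|sy_growth|sy_growth|sy_growth].
rewrite (eq_mean_sy P X Y l (g := fun s y =>
    (Lam + 1) / 4 + (- 2^-1) * s%:R + (4 * Lam)^-1 * s%:R ^+ 2 + 0 * 0)); last first.
  by move=> s y; field.
rewrite (@mean_sy_lin _ _ _ _ _ _ _ model m_gt0 _ l_pos _ _ _ _ (fun=> 0)).
  by congr EFin; field.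
exact: sy_growth_cst.
Qed.

End fixed_parameter.
End estimator_risks.

(** * Gamma integrals against the prior *)

Section gamma_tail.
Context (R : realType).

(* [gamma_tail c n x] is the integral of [t ^+ n * expR (- (c * t))] over [t >= x],
   by repeated integration by parts. *)
Fixpoint gamma_tail (c : R) (n : nat) (x : R) : R :=
  if n is p.+1 then (x ^+ n * expR (- (c * x)) + n%:R * gamma_tail c p x) / c
  else expR (- (c * x)) / c.

Lemma is_derive_expRN (c x : R) :
  is_derive x 1 (fun t => expR (- (c * t))) (- c * expR (- (c * x))).
Proof.
have h : is_derive x 1 (fun t => - (c * t)) (- c).
  have -> : (fun t : R => - (c * t)) = (fun t => (- c) *: t).
    by apply/funext => t; rewrite -mulNr.
  by apply: is_derive_eq; rewrite -[RHS]mulr1.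
have := @is_derive1_comp R expR (fun t => - (c * t)) x _ _ (is_derive_expR _) h.
by rewrite mulrC.
Qed.

Lemma is_derive_gamma_tail (c : R) n (x : R) : c != 0 ->
  is_derive x 1 (gamma_tail c n) (- (x ^+ n * expR (- (c * x)))).
Proof.
move=> c0; have hE := is_derive_expRN c x.
elim: n => [|n IHn].
  have -> : gamma_tail c 0 = c^-1 *: (fun t => expR (- (c * t))).
    by apply/funext => t; rewrite /= mulrC.
  apply: is_derive_eq; rewrite expr0 mul1r /GRing.scale /=.
  by rewrite mulNr mulrN mulKf.
have -> : gamma_tail c n.+1 = c^-1 *: ((fun t : R => t ^+ n.+1) *
    (fun t => expR (- (c * t))) + n.+1%:R *: gamma_tail c n).
  by apply/funext => t; rewrite /= mulrC.
have hX : is_derive x 1 (fun t : R => t ^+ n.+1) (n.+1%:R * x ^+ n).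
  have := @is_deriveX R R id n.+1 x 1 1 (is_derive_id _ _).
  by rewrite exprfctE /GRing.scale /= mulr1.
apply: is_derive_eq; rewrite /GRing.scale /=.
by rewrite exprS; field.
Qed.

Lemma gamma_tail0 (c : R) n : c != 0 -> gamma_tail c n 0 = n`!%:R / c ^+ n.+1.
Proof.
move=> c0; elim: n => [|n IHn] /=; rewrite mulr0 oppr0 expR0 ?expr1 //.
rewrite expr0n /= mul0r add0r IHn factS natrM [c ^+ n.+2]exprSr; field.
by rewrite c0 expf_neq0.
Qed.

(** One term of the exponential series bounds x^(p+1) exp (- c x) by a constant. Decay like 1 / x is
    enough to make the boundary term at infinity vanish. *)
Lemma gamma_tail_bound (c : R) n : 0 < c ->
  exists K, forall x, 0 < x -> `|gamma_tail c n x| <= K / x.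
Proof.
move=> c0.
have pow_exp p x : 0 < x -> x ^+ p * expR (- (c * x)) <= (p.+1`!%:R / c ^+ p.+1) / x.
  move=> x0; have := expR_ge1Dxn p (ltW (mulr_gt0 c0 x0)).
  have f0 : 0 < p.+1`!%:R :> R by rewrite ltr0n fact_gt0.
  move=> h; rewrite ler_pdivlMr // mulrAC -exprSr expRN ler_pdivrMr ?expR_gt0 //.
  rewrite mulrAC ler_pdivlMr ?exprn_gt0 // -exprMn [x * c]mulrC [leRHS]mulrC -ler_pdivrMr //.
  by apply: le_trans h; rewrite lerDr.
have c1 : 0 <= c^-1 by rewrite invr_ge0 ltW.
elim: n => [|n [K IHn]].
  exists (1 / c / c) => x x0 /=; have := pow_exp 0%N x x0; rewrite expr0 mul1r expr1.
  move=> h; rewrite ger0_norm ?divr_ge0 ?expR_ge0 ?(ltW c0) //.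
  by rewrite [leRHS]mulrAC ler_wpM2r.
exists ((n.+2`!%:R / c ^+ n.+2 + n.+1%:R * K) / c) => x x0 /=.
rewrite normrM [`|c^-1|]ger0_norm // [leRHS]mulrAC ler_wpM2r //.
rewrite (le_trans (ler_normD _ _)) // mulrDl lerD //.
  by rewrite ger0_norm ?pow_exp // mulr_ge0 ?expR_ge0 // exprn_ge0 // ltW.
by rewrite normrM ger0_norm // -mulrA ler_wpM2l // IHn.
Qed.

Lemma le0_of_le_div (a K : R) : (forall x, 0 < x -> a <= K / x) -> a <= 0.
Proof.
move=> h; rewrite leNgt; apply/negP => a0.
have x0 : 0 < (`|K| + 1) / a by rewrite divr_gt0 // ltr_wpDl.
have := h _ x0; rewrite invf_div mulrA ler_pdivlMr ?ltr_wpDl // [a * _]mulrC.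
by rewrite ler_pM2r //; have := ler_norm K; lra.
Qed.

(** The hypothesis is integrated against the density b exp (- b x) through an antiderivative: [H t]
    is the integral over x >= t of r minus the sum, times exp (- b x). It is nonincreasing and tends
    to 0 at infinity, so [0 <= H 0]. *)
Lemma exp_mean_le (J : Type) (s : seq J) (a : J -> R) (n : J -> nat) (b r : R) :
  0 < b ->
  (forall x, 0 < x -> \sum_(p <- s) a p * (x ^+ n p * expR (- (2 * x))) <= r) ->
  \sum_(p <- s) a p * (b * (n p)`!%:R / (2 + b) ^+ (n p).+1) <= r.
Proof.
move=> b0 hr; pose c := 2 + b.
have c0 : 0 < c by rewrite addr_gt0.
pose S t := \sum_(p <- s) a p * gamma_tail c (n p) t.
pose H t := r * gamma_tail b 0 t - S t.
have dS (x : R) : is_derive x 1 S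
    (- (\sum_(p <- s) a p * (x ^+ n p * expR (- (c * x))))).
  rewrite /S; elim: s {hr S H} => [|p s IHs].
    under eq_fun do rewrite big_nil.
    by rewrite big_nil oppr0; exact: is_derive_cst.
  under eq_fun do rewrite big_cons.
  have hp := is_derive_gamma_tail (n p) x (lt0r_neq0 c0).
  rewrite big_cons opprD; apply: is_deriveD.
  by have := @is_deriveZ _ _ _ _ (a p) _ _ _ hp; rewrite /GRing.scale /= mulrN.
have dH (x : R) : is_derive x 1 H (- r * expR (- (b * x)) +
    \sum_(p <- s) a p * (x ^+ n p * expR (- (c * x)))).
  have hp := is_derive_gamma_tail 0 x (lt0r_neq0 b0).
  have := @is_deriveZ _ _ _ _ r _ _ _ hp; rewrite /GRing.scale /= => h.
  have := @is_deriveB _ _ _ _ _ _ _ _ _ h (dS x).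
  by rewrite expr0 mul1r opprK mulrN -mulNr.
have dH_le (x : R) : 0 < x -> derive1 H x <= 0.
  move=> x0; rewrite derive1E (@derive_val _ _ _ _ _ _ _ (dH x)).
  have -> : \sum_(p <- s) a p * (x ^+ n p * expR (- (c * x))) =
      (\sum_(p <- s) a p * (x ^+ n p * expR (- (2 * x)))) * expR (- (b * x)).
    rewrite mulr_suml; apply: eq_bigr => p _.
    by rewrite /c mulrDl opprD expRD !mulrA.
  by rewrite -mulrDl mulr_le0_ge0 ?expR_ge0 // addrC subr_le0 hr.
have H_decr x : 0 < x -> H x <= H 0.
  move=> x0; apply: (@ler0_derive1_nincry _ H 0) => //.
  - by move=> t; rewrite in_itv /= andbT; exact: dH_le.
  - apply: derivable_within_continuous => t _.
    exact: (@ex_derive _ _ _ _ _ _ _ (dH t)).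
  exact: ltW.
have [K hK] : exists K, forall x, 0 < x -> `|H x| <= K / x.
  have [K1 hK1] := gamma_tail_bound 0 b0.
  have [K2 hK2] : exists K, forall x, 0 < x -> `|S x| <= K / x.
    rewrite /S; elim: s {hr S H dS dH dH_le H_decr} => [|p s [K IHs]].
      by exists 0 => x _; rewrite big_nil normr0 mul0r.
    have [L hL] := gamma_tail_bound (n p) c0.
    exists (`|a p| * L + K) => x x0; rewrite big_cons.
    rewrite (le_trans (ler_normD _ _)) // mulrDl lerD ?IHs //.
    by rewrite normrM -mulrA ler_wpM2l // hL.
  exists (`|r| * K1 + K2) => x x0; rewrite (le_trans (ler_normB _ _)) //.
  by rewrite mulrDl lerD ?hK2 // normrM -mulrA ler_wpM2l // hK1.
have : - H 0 <= 0.
  apply: (@le0_of_le_div _ K) => x x0.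
  have := H_decr x x0; have := hK x x0; rewrite ler_norml => /andP[]; lra.
rewrite /H /S gamma_tail0 ?lt0r_neq0 // expr1 fact0 mul1r.
move=> h; have {}h : S 0 <= r / b by rewrite /S; lra.
rewrite (_ : \sum_(p <- s) _ = b * S 0).
  by rewrite mulrC -ler_pdivlMr.
rewrite /S mulr_sumr; apply: eq_bigr => p _.
by rewrite gamma_tail0 ?lt0r_neq0 // /c; ring.
Qed.

End gamma_tail.

Section prior_mean.
Context (R : realType) (m : nat) (b : R).
Hypothesis b_gt0 : 0 < b.
Implicit Types (e : 'I_m -> nat) (l : 'rV[R]_m).

Definition monomial e l : R := \prod_j l 0 j ^+ e j.

(** The integral of t^n exp (- 2 t) against the density b exp (- b t). The 2 collects the
    exponential factors of the laws of X_i and of Y. *)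
Definition exp_moment (n : nat) : R := b * n`!%:R / (2 + b) ^+ n.+1.

(* [v] is the integral of [f l * expR (- 2 * \sum_j l 0 j)] when the [l 0 j] are
   independent exponential variables of parameter [b], [f] being a polynomial. *)
Definition prior_mean (f : 'rV[R]_m -> R) (v : R) : Prop :=
  exists s : seq (R * ('I_m -> nat)),
    (forall l, f l = \sum_(p <- s) p.1 * monomial p.2 l) /\
    v = \sum_(p <- s) p.1 * \prod_j exp_moment (p.2 j).

Lemma prior_mean_ext f g v w : (forall l, f l = g l) -> v = w ->
  prior_mean f v -> prior_mean g w.
Proof. by move=> fg <- [s [fs vs]]; exists s; split => // l; rewrite -fg. Qed.

Lemma prior_mean_monomial e :
  prior_mean (monomial e) (\prod_j exp_moment (e j)).
Proof.
exists [:: (1, e)]; split=> [l|]; by rewrite big_seq1 mul1r.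
Qed.

Lemma prior_mean0 : prior_mean (fun=> 0) 0.
Proof. by exists [::]; split=> [l|]; rewrite big_nil. Qed.

Lemma prior_meanD f g v w : prior_mean f v -> prior_mean g w ->
  prior_mean (fun l => f l + g l) (v + w).
Proof.
move=> [s [fs ->]] [t [gt ->]]; exists (s ++ t).
by split=> [l|]; rewrite big_cat // fs gt.
Qed.

Lemma prior_meanZ a f v : prior_mean f v ->
  prior_mean (fun l => a * f l) (a * v).
Proof.
move=> [s [fs ->]]; exists [seq (a * p.1, p.2) | p <- s].
by split=> [l|]; rewrite big_map ?fs mulr_sumr; apply: eq_bigr => p _; rewrite mulrA.
Qed.

Lemma prior_mean_sum (J : Type) (s : seq J) (f : J -> 'rV[R]_m -> R) (v : J -> R) :
  (forall j, prior_mean (f j) (v j)) ->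
  prior_mean (fun l => \sum_(j <- s) f j l) (\sum_(j <- s) v j).
Proof.
move=> fv; elim: s => [|j s IHs].
  by apply: prior_mean_ext prior_mean0 => [l|]; rewrite big_nil.
apply: prior_mean_ext (prior_meanD (fv j) IHs) => [l|]; by rewrite big_cons.
Qed.

(* The coordinates are integrated out one at a time, those of index below [k]
   being already integrated. *)
Lemma prior_mean_le f v r :
  (forall l, pos_param l -> f l * expR (- (2 * \sum_j l 0 j)) <= r) ->
  prior_mean f v -> v <= r.
Proof.
move=> fr [s [fs ->]].
pose F (k : nat) (l : 'rV[R]_m) (p : R * ('I_m -> nat)) (j : 'I_m) : R :=
  if (j < k)%N then exp_moment (p.2 j) else l 0 j ^+ p.2 j * expR (- (2 * l 0 j)).
suff H k : (k <= m)%N -> forall l, pos_param l ->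
    \sum_(p <- s) p.1 * \prod_j F k l p j <= r.
  (* Once all coordinates are integrated out nothing depends on [l], so any positive vector
     serves. *)
  have := H m (leqnn m) (const_mx 1); rewrite /F.
  under eq_bigr => p _ do under eq_bigr => j _ do rewrite ltn_ord.
  by apply => j; rewrite mxE.
elim: k => [_ l l0|k IHk km l l0].
  apply: le_trans (fr l l0); rewrite fs mulr_suml le_eqVlt; apply/orP; left.
  apply/eqP; apply: eq_bigr => p _; rewrite -mulrA; congr (_ * _).
  rewrite /F /= big_split /= -/(monomial _ _); congr (_ * _).
  rewrite mulr_sumr -sumrN; elim/big_rec2: _ => [|j y1 y2 _ ->]; first by rewrite expR0.
  by rewrite expRD.
pose i := Ordinal km.
pose a (p : R * ('I_m -> nat)) : R := p.1 * \prod_(j | j != i) F k l p j.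
have -> : \sum_(p <- s) p.1 * \prod_j F k.+1 l p j =
    \sum_(p <- s) a p * (b * (p.2 i)`!%:R / (2 + b) ^+ (p.2 i).+1).
  apply: eq_bigr => p _; rewrite (bigD1 i) //= {1}/F /= ltnSn /a.
  rewrite -/(exp_moment (p.2 i)) [X in _ * X = _]mulrC mulrA; congr (_ * _ * _).
  apply: eq_bigr => j ji; rewrite /F ltnS leq_eqVlt.
  by rewrite (_ : (_ == _) = false) //; apply/negbTE.
apply: (@exp_mean_le R _ s a (fun p => p.2 i)) => // x x0.
pose l' : 'rV[R]_m := \row_j if j == i then x else l 0 j.
have l'0 : pos_param l' by move=> j; rewrite mxE; case: ifP.
apply: le_trans (IHk (ltnW km) l' l'0); rewrite le_eqVlt; apply/orP; left.
apply/eqP; apply: eq_bigr => p _; rewrite (bigD1 i) //= {1}/F /= ltnn mxE eqxx /a.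
rewrite [X in _ = _ * X]mulrC [RHS]mulrA; congr (_ * _ * _).
by apply: eq_bigr => j /negbTE ji; rewrite /F mxE ji.
Qed.

End prior_mean.

(** * Marginal probabilities of the counts under the prior *)

Section marginal_likelihood.
Context (R : realType) (m : nat) (m_gt0 : (0 < m)%N) (b : R).
Hypothesis b_gt0 : 0 < b.
Implicit Types (e : 'I_m -> nat) (l : 'rV[R]_m).

Definition incr_exp e (i : 'I_m) : 'I_m -> nat := fun j => (e j + (j == i))%N.

Definition total_exp e : nat := (\sum_j e j)%N.

(** The factorials and the factor exp (- 2 Lam) are split off: the former are constants, the latter
    is built into [prior_mean]. *)
Definition likelihood e (y : nat) l : R := monomial e l * (\sum_j l 0 j) ^+ y.

(** For y = 0 this is a product of [exp_moment]s. Under the posterior given X = e alone, weighted by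
    exp (- 2 Lam), Lam has a gamma law of shape s + m and rate 2 + b; the quotient of factorials and
    y factors 1 / (2 + b) form its moment of order y. *)
Definition marginal e (y : nat) : R :=
  b ^+ m * (\prod_j (e j)`!%:R) * (total_exp e + y + m.-1)`!%:R /
  (total_exp e + m.-1)`!%:R / (2 + b) ^+ (total_exp e + y + m).

Lemma total_incr_exp e i : total_exp (incr_exp e i) = (total_exp e).+1.
Proof.
rewrite /total_exp /incr_exp big_split /= [X in (_ + X)%N](bigD1 i) //= eqxx.
by rewrite [X in (_ + (_ + X))%N]big1 ?addn0 ?addn1 // => j /negbTE ->.
Qed.

Lemma monomial_incr e i l : monomial (incr_exp e i) l = l 0 i * monomial e l.
Proof.
rewrite /monomial (bigD1 i) //= [in RHS](bigD1 i) //= /incr_exp eqxx addn1 exprS.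
rewrite mulrA; congr (_ * _); apply: eq_bigr => j /negbTE ->.
by rewrite addn0.
Qed.

Let c_neq0 : 2 + b != 0. Proof. by rewrite lt0r_neq0 // addr_gt0. Qed.

Let fact_neq0 n : n`!%:R != 0 :> R.
Proof. by rewrite pnatr_eq0 -lt0n fact_gt0. Qed.

Lemma marginal_incr e i y : marginal (incr_exp e i) y =
  marginal e y * ((e i).+1%:R * (total_exp e + y + m)%:R) /
  ((total_exp e + m)%:R * (2 + b)).
Proof.
rewrite /marginal total_incr_exp.
have -> : \prod_j (incr_exp e i j)`!%:R = (e i).+1%:R * \prod_j (e j)`!%:R :> R.
  rewrite (bigD1 i) //= [in RHS](bigD1 i) //= /incr_exp eqxx addn1 factS natrM mulrA.
  by congr (_ * _); apply: eq_bigr => j /negbTE ->; rewrite addn0.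
have E n : (n.+1 + m.-1 = n + m)%N by rewrite addSnnS prednK.
have F n : (n + m)`!%:R = (n + m)%:R * (n + m.-1)`!%:R :> R.
  by case: (m) m_gt0 => // p _; rewrite addnS factS natrM.
rewrite [(_.+1 + y)%N]addSn !E !F.
have -> : (2 + b) ^+ ((total_exp e + y).+1 + m) =
    (2 + b) ^+ (total_exp e + y + m) * (2 + b) by rewrite addSn exprSr.
have h1 : (total_exp e + m)%:R != 0 :> R by rewrite pnatr_eq0 -lt0n addn_gt0 m_gt0 orbT.
have h2 := fact_neq0 (total_exp e + m.-1).
have h3 : (2 + b) ^+ (total_exp e + y + m) != 0 by rewrite expf_neq0.
move: (total_exp e + m)%:R h1 => u h1; move: (_ ^+ (_ + m)) h3 => v h3.
move: (total_exp e + m.-1)`!%:R h2 => w h2.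
by field; rewrite h1 h2 h3 c_neq0.
Qed.

(** Induction on [y]: one factor Lam splits the likelihood into those with one exponent raised, and
    the sum of [(e i).+1] cancels the denominator [total_exp e + m] of [marginal_incr]. *)
Lemma prior_mean_likelihood e y :
  prior_mean b (likelihood e y) (marginal e y).
Proof.
elim: y e => [|y IHy] e.
  apply: prior_mean_ext (prior_mean_monomial b e) => [l|].
    by rewrite /likelihood expr0 mulr1.
  rewrite /marginal addn0 mulfK ?fact_neq0 //.
  rewrite /exp_moment !big_split /= prodr_const card_ord; congr (_ * _ * _).
  rewrite prodfV; congr (_^-1).
  under eq_bigr do rewrite exprS.
  by rewrite big_split /= prodr_const card_ord prodrXr exprD mulrC.
apply: prior_mean_ext (prior_mean_sum (index_enum 'I_m)
  (fun i => IHy (incr_exp e i))) => [l|].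
  rewrite /likelihood exprS mulrCA [RHS]mulrC mulr_sumr; apply: eq_bigr => i _.
  by rewrite monomial_incr; ring.
under eq_bigr do rewrite marginal_incr.
rewrite (eq_bigr (fun i => (e i).+1%:R * (marginal e y * (total_exp e + y + m)%:R /
  ((total_exp e + m)%:R * (2 + b))))); last first.
  by move=> i _; move: (marginal e y) => v; rewrite -!mulrA mulrCA.
rewrite -mulr_suml.
have -> : \sum_i (e i).+1%:R = (total_exp e + m)%:R :> R.
  under eq_bigr do rewrite -natr1.
  by rewrite big_split /= sumr_const card_ord natrD /total_exp natr_sum.
have h1 : (total_exp e + m)%:R != 0 :> R by rewrite pnatr_eq0 -lt0n addn_gt0 m_gt0 orbT.
have F : (total_exp e + y.+1 + m.-1)`!%:R =
    (total_exp e + y + m)%:R * (total_exp e + y + m.-1)`!%:R :> R.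
  by rewrite addnS; case: (m) m_gt0 => // p _; rewrite addSn factS natrM addnS.
rewrite /marginal F.
have -> : (2 + b) ^+ (total_exp e + y.+1 + m) =
    (2 + b) ^+ (total_exp e + y + m) * (2 + b) by rewrite addnS addSn exprSr.
have h2 := fact_neq0 (total_exp e + m.-1).
have h3 : (2 + b) ^+ (total_exp e + y + m) != 0 by rewrite expf_neq0.
move: (total_exp e + m)%:R h1 => u h1; move: (_ ^+ (_ + m)) h3 => v h3.
move: (total_exp e + m.-1)`!%:R h2 => w h2.
by field; rewrite h1 h2 h3 c_neq0.
Qed.

End marginal_likelihood.

(** * The Bayes risk and its limit *)

Section bayes_risk.
Context (R : realType) (m : nat) (m_gt0 : (0 < m)%N) (b : R).
Hypothesis b_gt0 : 0 < b.
Implicit Types (e : 'I_m -> nat) (l : 'rV[R]_m) (y : nat).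
Local Notation n e := (total_exp e + m.-1)%N.
Local Notation kap := (m.-1%:R : R).

Let c_gt0 : 0 < 2 + b. Proof. by rewrite addr_gt0. Qed.

Lemma likelihood_ge0 e y l : pos_param l -> 0 <= likelihood e y l.
Proof.
move=> l0; rewrite mulr_ge0 ?exprn_ge0 ?sumr_ge0 //.
  by apply: prodr_ge0 => j _; rewrite exprn_ge0 // ltW.
by move=> i _; exact/ltW/l0.
Qed.

Lemma likelihood_incr e i y l :
  likelihood (incr_exp e i) y l = l 0 i * likelihood e y l.
Proof. by rewrite /likelihood monomial_incr mulrA. Qed.

Lemma likelihood_ext e e' y l : e =1 e' -> likelihood e y l = likelihood e' y l.
Proof. by move=> ee; congr (_ * _); apply: eq_bigr => j _; rewrite ee. Qed.

Lemma marginal_ext e e' y : e =1 e' -> marginal b e y = marginal b e' y.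
Proof.
move=> ee; rewrite /marginal.
have -> : total_exp e = total_exp e' by apply: eq_bigr => j _; rewrite ee.
by congr (_ * _ * _ / _ / _); apply: eq_bigr => j _; rewrite ee.
Qed.

(** For the loss (d - l)^2 / l the Bayes estimate is 1 / E[1 / l] under the posterior, hence the
    quotient of [marginal b e y] by the marginal with [e i] lowered by one. *)
Definition bayes_est e i y : R :=
  (e i)%:R * (n e + y)%:R / ((n e)%:R * (2 + b)).

(* A quadratic loss is bounded below by its tangent at the Bayes estimate; the
   prior mean of the linear term vanishes. *)
Lemma coordinate_bayes_risk e i y (dl : R) : (0 < e i)%N ->
  exists2 f, (forall l, pos_param l -> f l <= (dl - l 0 i) ^+ 2 / l 0 i * likelihood e y l)
  & prior_mean b f (marginal b (incr_exp e i) y - bayes_est e i y * marginal b e y).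
Proof.
(* As [e i] is positive, dividing the likelihood by [l 0 i] just lowers this exponent. *)
move=> ei; pose e' := fun j => (e j - (j == i))%N.
have eE : e =1 incr_exp e' i.
  by move=> j; rewrite /incr_exp /e'; case: eqP => [->|_]; rewrite ?subnK // subn0 addn0.
set t := bayes_est e i y.
exists (fun l => (2 * dl * t - t ^+ 2) * likelihood e' y l +
    (- 2 * dl) * likelihood e y l + likelihood (incr_exp e i) y l).
  move=> l l0; rewrite likelihood_incr (likelihood_ext _ _ eE) likelihood_incr.
  have := likelihood_ge0 e' y l0; set L := likelihood e' y l => L0.
  rewrite -subr_ge0 (_ : _ - _ = (dl - t) ^+ 2 * L); first by rewrite mulr_ge0 ?sqr_ge0.
  by field; rewrite gt_eqF.
have M := prior_mean_likelihood m_gt0 b_gt0.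
apply: prior_mean_ext (prior_meanD (prior_meanD
  (prior_meanZ (2 * dl * t - t ^+ 2) (M e' y)) (prior_meanZ (- 2 * dl) (M e y)))
  (M (incr_exp e i) y)) => //.
have tM : marginal b e y = t * marginal b e' y.
  have totE : total_exp e = (total_exp e').+1.
    rewrite -(total_incr_exp e' i); by apply: eq_bigr => j _; rewrite eE.
  have eiE : e i = (e' i).+1 by rewrite eE /incr_exp eqxx addn1.
  have h1 : ((total_exp e').+1 + m.-1 = total_exp e' + m)%N.
    by rewrite addSnnS prednK.
  rewrite (marginal_ext _ eE) (marginal_incr m_gt0 b_gt0) /t /bayes_est totE h1 eiE.
  by rewrite (addnAC _ m y) [RHS]mulrC -mulrA.
by rewrite tM; ring.
Qed.

(** With n = s + k, the numerator s + y + m - s (n + y) / n simplifies to m + k y / n. Positivity of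
    s keeps n nonzero when m = 1. *)
Lemma sum_bayes_risk e y : (0 < total_exp e)%N ->
  \sum_i (marginal b (incr_exp e i) y - bayes_est e i y * marginal b e y) =
  marginal b e y * ((1 + kap + kap * y%:R / (n e)%:R) / (2 + b)).
Proof.
move=> e0.
have mE : m%:R = kap + 1 :> R by rewrite natr1 prednK.
have totE : \sum_i (e i)%:R = (total_exp e)%:R :> R by rewrite /total_exp natr_sum.
have n0 : (n e)%:R != 0 :> R by rewrite pnatr_eq0 -lt0n addn_gt0 e0.
have n1 : (total_exp e + m)%:R != 0 :> R by rewrite pnatr_eq0 -lt0n addn_gt0 e0.
rewrite sumrB -mulr_suml.
have -> : \sum_i marginal b (incr_exp e i) y =
    marginal b e y * ((total_exp e + y + m)%:R / (2 + b)).
  under eq_bigr do rewrite (marginal_incr m_gt0 b_gt0) -mulrA.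
  rewrite -mulr_sumr; congr (_ * _).
  rewrite -mulr_suml -mulr_suml.
  under eq_bigr do rewrite -natr1.
  rewrite big_split /= sumr_const card_ord totE -natrD.
  move: (_ + m)%:R n1 => u u0; field.
  by rewrite u0 lt0r_neq0.
have -> : \sum_i bayes_est e i y =
    (total_exp e)%:R * (n e + y)%:R / ((n e)%:R * (2 + b)).
  by rewrite /bayes_est -mulr_suml -mulr_suml totE.
rewrite [X in _ - X]mulrC -mulrBr; congr (_ * _).
move: n0; rewrite !natrD mE => n0.
by field; rewrite n0 lt0r_neq0.
Qed.

(** The marginal probability of an outcome depends on [e] only through n, with negative binomial
    weights in [y]. *)
Lemma marginal_binomial e y :
  marginal b e y / ((\prod_j (e j)`!%:R) * y`!%:R) =
  b ^+ m * 'C(n e + y, y)%:R * (2 + b)^-1 ^+ (n e + y).+1.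
Proof.
have E : (total_exp e + y + m = (n e + y).+1)%N.
  by rewrite addnAC -addSn -addnS prednK.
have B : (total_exp e + y + m.-1)`!%:R =
    'C(n e + y, y)%:R * y`!%:R * (n e)`!%:R :> R.
  by rewrite addnAC -(bin_fact (leq_addl (n e) y)) addnK !natrM mulrA.
have fact_neq0 k : k`!%:R != 0 :> R by rewrite pnatr_eq0 -lt0n fact_gt0.
have p0 : \prod_j (e j)`!%:R != 0 :> R by apply/prodf_neq0 => j _.
rewrite /marginal B E exprVn; move: (\prod_j _) p0 => p p0.
have := fact_neq0 (n e); move: (n e)`!%:R => u u0.
have := fact_neq0 y; move: y`!%:R => v v0.
have : (2 + b) ^+ (n e + y).+1 != 0 by rewrite expf_neq0 // lt0r_neq0.
move: (_ ^+ (n e + y).+1) => w w0.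
by field; rewrite u0 v0 w0 p0.
Qed.

Definition pos_exp N (x : {ffun 'I_m -> 'I_N}) : 'I_m -> nat := fun j => (x j).+1.

Lemma total_pos_exp_gt0 N (x : {ffun 'I_m -> 'I_N}) : (0 < total_exp (pos_exp x))%N.
Proof.
by rewrite /total_exp (bigD1 (Ordinal m_gt0)).
Qed.

Lemma bayes_risk_le (delta : estimator R m) r N K :
  (forall l, pos_param l ->
    \sum_(x : {ffun 'I_m -> 'I_N}) \sum_(y < K)
      loss (delta (\row_j pos_exp x j) y) l *
      (likelihood (pos_exp x) y l / ((\prod_j (pos_exp x j)`!%:R) * y`!%:R)) *
      expR (- (2 * \sum_j l 0 j)) <= r) ->
  \sum_(x : {ffun 'I_m -> 'I_N}) \sum_(y < K)
    b ^+ m * 'C(n (pos_exp x) + y, y)%:R * (2 + b)^-1 ^+ (n (pos_exp x) + y).+1 *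
    ((1 + kap + kap * y%:R / (n (pos_exp x))%:R) / (2 + b)) <= r.
Proof.
move=> hr.
pose D (x : {ffun 'I_m -> 'I_N}) (y : nat) := delta (\row_j pos_exp x j) y.
pose w (x : {ffun 'I_m -> 'I_N}) (y : nat) : R :=
  ((\prod_j (pos_exp x j)`!%:R) * y`!%:R)^-1.
have w0 x y : 0 <= w x y.
  by rewrite invr_ge0 mulr_ge0 //; apply: prodr_ge0.
(* The lower bounds are chosen as a family indexed by the outcomes, the form that [prior_mean_sum]
   takes. *)
have f_ex (x : {ffun 'I_m -> 'I_N}) (y : nat) : {f | 
    (forall l, pos_param l -> f l <= loss (D x y) l * likelihood (pos_exp x) y l)
  & prior_mean b f (marginal b (pos_exp x) y *
      ((1 + kap + kap * y%:R / (n (pos_exp x))%:R) / (2 + b)))}.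
  apply: cid2.
  have ex i : {f | (forall l, pos_param l -> f l <=
      (D x y 0 i - l 0 i) ^+ 2 / l 0 i * likelihood (pos_exp x) y l)
    & prior_mean b f (marginal b (incr_exp (pos_exp x) i) y -
        bayes_est (pos_exp x) i y * marginal b (pos_exp x) y)}.
    by apply: cid2; exact: coordinate_bayes_risk.
  exists (fun l => \sum_i s2val (ex i) l).
    move=> l l0; rewrite /loss mulr_suml; apply: ler_sum => i _.
    exact: (s2valP (ex i)).
  rewrite -sum_bayes_risk ?total_pos_exp_gt0 //.
  by apply: prior_mean_sum => i; exact: (s2valP' (ex i)).
pose f x y := s2val (f_ex x y).
pose V (x : {ffun 'I_m -> 'I_N}) (y : nat) : R := marginal b (pos_exp x) y *
  ((1 + kap + kap * y%:R / (n (pos_exp x))%:R) / (2 + b)).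
apply: (@prior_mean_le R m b b_gt0
  (fun l => \sum_(x : {ffun 'I_m -> 'I_N}) \sum_(y < K) w x y * f x y l)).
  move=> l l0; apply: le_trans (hr l l0).
  rewrite mulr_suml; apply: ler_sum => x _.
  rewrite mulr_suml; apply: ler_sum => y _.
  rewrite ler_wpM2r ?expR_ge0 // [leRHS]mulrA mulrC ler_wpM2r //.
  exact: (s2valP (f_ex x y)).
apply: prior_mean_ext (prior_mean_sum _ (fun x => prior_mean_sum _
  (fun y : 'I_K => prior_meanZ (w x y) (s2valP' (f_ex x y))))) => //.
apply: eq_bigr => x _; apply: eq_bigr => y _.
by rewrite -marginal_binomial mulrA; congr (_ * _); rewrite mulrC.
Qed.

End bayes_risk.

(** * The negative binomial series *)

Section negative_binomial_series.
Context (R : realType) (z : R).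
Hypothesis z01 : 0 <= z < 1.

Definition negbin_sum n K : R := \sum_(y < K) 'C(n + y, y)%:R * z ^+ y.

Lemma negbin_sum_rec n K :
  negbin_sum n.+1 K.+1 = negbin_sum n K.+1 + z * negbin_sum n.+1 K.
Proof.
rewrite /negbin_sum big_ord_recl [in RHS]big_ord_recl /= !bin0 -addrA.
congr (_ + _); rewrite mulr_sumr -big_split /=; apply: eq_bigr => y _.
rewrite /bump /= add1n addSn binS natrD mulrDl addSnnS; congr (_ + _).
by rewrite exprS; ring.
Qed.

Lemma negbin_sum_nondecreasing n : nondecreasing_seq (negbin_sum n).
Proof.
apply/nondecreasing_seqP => K; rewrite /negbin_sum big_ord_recr lerDl.
by case/andP: z01 => z0 _; rewrite mulr_ge0 ?exprn_ge0.
Qed.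

(** By Pascal's rule, in the form [negbin_sum_rec], the limit L for n + 1 satisfies L = (1 -
    z)^-(n+1) + z L. The same recursion bounds the partial sums, so that L exists. *)
Lemma cvg_negbin_sum n : negbin_sum n @ \oo --> (1 - z)^-1 ^+ n.+1.
Proof.
have [z0 z1] := andP z01; have oz : 0 < 1 - z by rewrite subr_gt0.
elim: n => [|n IHn].
  have -> : negbin_sum 0 = series (geometric 1 z).
    apply/funext => K; rewrite /series /= big_mkord.
    by apply: eq_bigr => y _; rewrite add0n binn.
  rewrite expr1 -[X in _ --> X]mul1r; apply: cvg_geometric_series.
  by rewrite ger0_norm.
have le_lim K : negbin_sum n K <= (1 - z)^-1 ^+ n.+1.
  rewrite -(cvg_lim _ IHn) //; apply: nondecreasing_cvgn_le.
    exact: negbin_sum_nondecreasing.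
  by apply/cvg_ex; eexists; exact: IHn.
have cv : cvgn (negbin_sum n.+1).
  apply: nondecreasing_is_cvgn; first exact: negbin_sum_nondecreasing.
  exists ((1 - z)^-1 ^+ n.+2) => _ [K _ <-].
  rewrite exprS -ler_pdivrMl ?invr_gt0 // invrK.
  apply: le_trans (le_lim K.+1); have := negbin_sum_rec n K.
  by have := negbin_sum_nondecreasing n.+1 (leqnSn K); lra.
pose L := limn (negbin_sum n.+1); have cL : negbin_sum n.+1 @ \oo --> L by [].
suff -> : (1 - z)^-1 ^+ n.+2 = L by [].
have c1 : (fun K => negbin_sum n.+1 K.+1) @ \oo --> L by rewrite cvg_shiftS.
have c2 : (fun K => negbin_sum n K.+1) @ \oo --> (1 - z)^-1 ^+ n.+1.
  by rewrite cvg_shiftS.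
have c3 : (fun K => negbin_sum n K.+1 + z * negbin_sum n.+1 K) @ \oo -->
    (1 - z)^-1 ^+ n.+1 + z * L.
  by apply: cvgD => //; apply: cvgMr.
have eqf : (fun K => negbin_sum n.+1 K.+1) =
    (fun K => negbin_sum n K.+1 + z * negbin_sum n.+1 K).
  by apply/funext => K; exact: negbin_sum_rec.
rewrite eqf in c1.
have E : L = (1 - z)^-1 ^+ n.+1 + z * L by exact: cvg_unique c1 c3.
rewrite exprS; apply: (mulfI (lt0r_neq0 oz)); rewrite mulrA mulfV ?mul1r ?lt0r_neq0 //.
by rewrite mulrBl mul1r {1}E; ring.
Qed.

End negative_binomial_series.

Section minimax_bound.
Context (R : realType) (m : nat) (m_gt0 : (0 < m)%N).
Local Notation kap := (m.-1%:R : R).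
Context (delta : estimator R m) (r : R).
Hypothesis bounded : forall N K (l : 'rV[R]_m), pos_param l ->
  \sum_(x : {ffun 'I_m -> 'I_N}) \sum_(y < K)
    loss (delta (\row_j pos_exp x j) y) l *
    (likelihood (pos_exp x) y l / ((\prod_j (pos_exp x j)`!%:R) * y`!%:R)) *
    expR (- (2 * \sum_j l 0 j)) <= r.

Lemma bayes_risk_sum_le (b : R) N : 0 < b ->
  \sum_(x : {ffun 'I_m -> 'I_N}) b ^+ m * (1 + b)^-1 ^+ (total_exp (pos_exp x) + m) *
    ((1 + kap + kap / (1 + b)) / (2 + b)) <= r.
Proof.
move=> b0; pose z := (2 + b)^-1.
have c0 : 0 < 2 + b by rewrite addr_gt0.
have z01 : 0 <= z < 1 by rewrite invr_ge0 (ltW c0) invf_lt1 //=; lra.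
have z0 : 0 <= z by case/andP: z01.
(* Hence the powers of z cancel in the limit, leaving powers of 1 / (1 + b). *)
have z1 : 1 - z = (1 + b) * z by rewrite /z; field; rewrite lt0r_neq0.
pose n (x : {ffun 'I_m -> 'I_N}) := (total_exp (pos_exp x) + m.-1)%N.
(* The sum over y of the partial Bayes risk, with a factor (n + 1) / n lowered to 1 in its last
   term: both sums become negative binomial ones. *)
pose g x K := b ^+ m * z ^+ (n x).+2 *
  ((1 + kap) * negbin_sum z (n x) K.+1 + kap * (z * negbin_sum z (n x).+1 K)).
have gr K : \sum_x g x K <= r.
  apply: le_trans (bayes_risk_le m_gt0 b0 (@bounded N K.+1)).
  apply: ler_sum => x _; rewrite /g -/(n x) -/z.
  have n0 : (0 < n x)%N by rewrite addn_gt0 total_pos_exp_gt0.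
  have -> : (1 + kap) * negbin_sum z (n x) K.+1 + kap * (z * negbin_sum z (n x).+1 K) =
      \sum_(y < K.+1) ((1 + kap) * ('C(n x + y, y)%:R * z ^+ y) +
        kap * (if val y is y'.+1 then 'C((n x).+1 + y', y')%:R * z ^+ y else 0)).
    rewrite big_split /= -!mulr_sumr; congr (_ + _ * _).
    rewrite big_ord_recl /= add0r mulr_sumr; apply: eq_bigr => y _.
    by rewrite /bump /= add1n exprS; ring.
  rewrite mulr_sumr; apply: ler_sum => y _.
  rewrite -subr_ge0.
  set q := (if _ is _.+1 then _ else _).
  (* Absorption: [y * 'C(n + y, y) = (n + 1) * 'C(n + y, y - 1)]. *)
  have q_le : q <= 'C(n x + y, y)%:R * z ^+ y * y%:R / (n x)%:R.
    rewrite {}/q; case: y => -[|y] /= _; first by rewrite mulr0 mul0r.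
    rewrite [leRHS](_ : _ = 'C(n x + y.+1, y.+1)%:R * y.+1%:R / (n x)%:R * z ^+ y.+1).
      rewrite ler_wpM2r ?exprn_ge0 // ler_pdivlMr ?ltr0n // -!natrM ler_nat.
      rewrite [leqRHS]mulnC mul_bin_left addSnnS mulnC leq_mul2r; apply/orP; right.
      by rewrite -addSnnS addnK leqnSn.
    by ring.
  have -> : b ^+ m * 'C(n x + y, y)%:R * z ^+ (n x + y).+1 *
      ((1 + kap + kap * y%:R / (n x)%:R) / (2 + b)) -
      b ^+ m * z ^+ (n x).+2 * ((1 + kap) * ('C(n x + y, y)%:R * z ^+ y) + kap * q) =
      b ^+ m * z ^+ (n x).+2 * kap *
        ('C(n x + y, y)%:R * z ^+ y * y%:R / (n x)%:R - q).
    rewrite -/z.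
    have -> : z ^+ (n x + y).+1 = z * (z ^+ n x * z ^+ y) by rewrite exprS exprD.
    have -> : z ^+ (n x).+2 = z * (z * z ^+ n x) by rewrite !exprS.
    by move: (n x)%:R^-1 'C(_, _)%:R => u v; ring.
  apply: mulr_ge0; last by rewrite subr_ge0.
  by apply: mulr_ge0 => //; apply: mulr_ge0; apply: exprn_ge0 => //; exact: ltW.
have g_cvg x : g x @ \oo --> b ^+ m * z ^+ (n x).+2 *
    ((1 + kap) * (1 - z)^-1 ^+ (n x).+1 + kap * (z * (1 - z)^-1 ^+ (n x).+2)).
  apply: cvgMr; apply: cvgD; apply: cvgMr.
    by have := @cvg_negbin_sum R z z01 (n x); rewrite -cvg_shiftS.
  by apply: cvgMr; exact: cvg_negbin_sum.
have sum_cvg : (fun K => \sum_x g x K) @ \oo --> \sum_x (b ^+ m * z ^+ (n x).+2 *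
    ((1 + kap) * (1 - z)^-1 ^+ (n x).+1 + kap * (z * (1 - z)^-1 ^+ (n x).+2))).
  by apply: cvg_big => [|x _]; [exact: add_continuous|exact: g_cvg].
apply: le_trans (cvgr_to_le sum_cvg _); last exact: nearW.
apply: ler_sum => x _; rewrite le_eqVlt; apply/orP; left; apply/eqP.
have -> : (total_exp (pos_exp x) + m = (n x).+1)%N by rewrite -addnS prednK.
have zn : z != 0 by rewrite invr_neq0 // lt0r_neq0.
have bn : 1 + b != 0 by rewrite lt0r_neq0 // addr_gt0.
rewrite -/z z1; clearbody z.
rewrite invfM !exprMn !exprVn.
have : z ^+ (n x) != 0 by rewrite expf_neq0.
have : (1 + b) ^+ (n x) != 0 by rewrite expf_neq0.
rewrite !exprS; move: ((1 + b) ^+ n x) (z ^+ n x) => u v u0 v0.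
by field; rewrite u0 v0 zn.
Qed.

(** With q = 1 / (1 + b), the summand b^m q^(s + m) is a product over the coordinates, so the sum
    over outcomes is the m-th power of a geometric sum. *)
Lemma bayes_risk_geometric (b : R) N : 0 < b ->
  ((1 + b)^-1 * (1 - (1 + b)^-1 ^+ N)) ^+ m *
    ((1 + kap + kap / (1 + b)) / (2 + b)) <= r.
Proof.
move=> b0; apply: le_trans (bayes_risk_sum_le N b0).
rewrite -mulr_suml le_eqVlt; apply/orP; left; apply/eqP; congr (_ * _).
set q := (1 + b)^-1.
have bq : b * q = 1 - q by rewrite /q; field; rewrite lt0r_neq0 // addr_gt0.
have -> : q * (1 - q ^+ N) = \sum_(i < N) b * q ^+ i.+2.
  have := subrX1 q N; rewrite -opprB -[q - 1]opprB mulNr => /oppr_inj ->.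
  rewrite -bq mulrCA !mulr_sumr; apply: eq_bigr => i _.
  by rewrite !exprS; ring.
rewrite -[in LHS](card_ord m) -prodr_const bigA_distr_bigA /=.
apply: eq_bigr => x _; rewrite big_split /= prodr_const card_ord; congr (_ * _).
rewrite prodrXr; congr (_ ^+ _).
under eq_bigr => j _ do rewrite -addn1.
by rewrite big_split /= sum_nat_const card_ord muln1.
Qed.

Lemma minimax_bound : 1 + 2 * kap <= 2 * r.
Proof.
(* The limit N -> oo with denominators cleared: what remains is polynomial in [b], and b -> 0 along
   [harmonic] follows by continuity. *)
have H (b : R) : 0 < b -> 1 + 2 * kap <= r * ((1 + b) ^+ m.+1 * (2 + b)).
  move=> b0; have b1 : 0 < 1 + b by rewrite addr_gt0.
  have b2 : 0 < 2 + b by rewrite addr_gt0.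
  pose h N : R := ((1 + b)^-1 * (1 - (1 + b)^-1 ^+ N)) ^+ m *
    ((1 + kap + kap / (1 + b)) / (2 + b)).
  have q1 : `|(1 + b)^-1| < 1.
    by rewrite ger0_norm ?invr_ge0 ?(ltW b1) // invf_lt1 // ltrDl.
  have cX : (fun N => ((1 + b)^-1 * (1 - (1 + b)^-1 ^+ N)) ^+ m) @ \oo -->
      ((1 + b)^-1 * (1 - 0)) ^+ m.
    apply: (@cvg_comp _ _ _ (fun N => (1 + b)^-1 * (1 - (1 + b)^-1 ^+ N))
      (fun t : R => t ^+ m)); last exact: exprn_continuous.
    apply: cvgMr; apply: cvgB; [exact: cvg_cst|exact: cvg_expr].
  have ch : h @ \oo --> ((1 + b)^-1 * (1 - 0)) ^+ m *
      ((1 + kap + kap / (1 + b)) / (2 + b)) by apply: cvgMl.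
  have : ((1 + b)^-1 * (1 - 0)) ^+ m * ((1 + kap + kap / (1 + b)) / (2 + b)) <= r.
    apply: cvgr_to_le ch _; apply: nearW => N; exact: bayes_risk_geometric.
  rewrite subr0 mulr1 exprVn mulrC ler_pdivrMr ?exprn_gt0 // ler_pdivrMr // => hr.
  rewrite exprS.
  have -> : r * ((1 + b) * (1 + b) ^+ m * (2 + b)) =
    (1 + b) * (r * (1 + b) ^+ m * (2 + b)) by ring.
  apply: (@le_trans _ _ ((1 + b) * (1 + kap + kap / (1 + b)))).
    rewrite mulrDr mulrCA mulfV ?lt0r_neq0 // mulr1.
    have := ler0n R m.-1; have : 0 <= b * kap by rewrite mulr_ge0 // ltW.
    lra.
  by rewrite ler_pM2l.
have c0 : (fun t => r * ((1 + harmonic t) ^+ m.+1 * (2 + harmonic t))) @ \oo -->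
    r * ((1 + 0) ^+ m.+1 * (2 + 0)).
  apply: cvgMr; apply: cvgM.
    apply: (@cvg_comp _ _ _ (fun t => 1 + harmonic t) (fun t : R => t ^+ m.+1)).
      by apply: cvgD; [exact: cvg_cst|exact: cvg_harmonic].
    exact: exprn_continuous.
  by apply: cvgD; [exact: cvg_cst|exact: cvg_harmonic].
have : 1 + 2 * kap <= r * ((1 + 0) ^+ m.+1 * (2 + 0)).
  apply: cvgr_to_ge c0 _; apply: nearW => t; apply: H; exact: harmonic_gt0.
by rewrite !addr0 expr1n mul1r [r * _]mulrC.
Qed.

End minimax_bound.

(** * Minimaxity *)

Section minimax_value.
Context (d : measure_display) (T : measurableType d) (R : realType) (m : nat).
Context (P : 'rV[R]_m -> probability T R).
Context (X : 'I_m -> {mfun T >-> nat}) (Y : {mfun T >-> nat}).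
Hypothesis model : Poisson_model P X Y.
Hypothesis m_gt0 : (0 < m)%N.

Lemma loss_ge0 (e l : 'rV[R]_m) : pos_param l -> 0 <= loss e l.
Proof.
by move=> l0; apply: sumr_ge0 => i _; rewrite divr_ge0 ?sqr_ge0 // ltW // l0.
Qed.

Lemma le_sup_risk (delta : estimator R m) l : pos_param l ->
  (risk P X Y delta l <= sup_risk P X Y delta)%E.
Proof. by move=> l0; apply: ereal_sup_ubound; exists l. Qed.

Definition count_vector (e : 'I_m -> nat) (y : nat) : {ffun option 'I_m -> nat} :=
  [ffun o => if o is Some i then e i else y].

Lemma joint_pmf_count_vector (l : 'rV[R]_m) e y : pos_param l ->
  joint_pmf (rate l) (count_vector e y) =
  likelihood e y l / ((\prod_j (e j)`!%:R) * y`!%:R) *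
  expR (- (2 * \sum_j l 0 j)).
Proof.
move=> l0; have L0 := Lam_gt0 m_gt0 l0.
rewrite /joint_pmf (bigD1 None) //= (reindex_omap Some id) /=; last by case.
rewrite ffunE /= {1}/poisson_pmf L0.
have -> : \prod_(i | Some (Some i) == Some (Some i))
    poisson_pmf (l 0 i) (count_vector e y (Some i)) =
    \prod_i (l 0 i ^+ e i * (e i)`!%:R^-1 * expR (- l 0 i)).
  apply: eq_big => [i|i _]; first by rewrite eqxx.
  by rewrite /count_vector ffunE /poisson_pmf l0.
rewrite !big_split /= prodfV -expR_sum -sumrN.
have -> : - (2 * \sum_j l 0 j) = - (\sum_j l 0 j) + - (\sum_j l 0 j) by ring.
rewrite expRD /likelihood /monomial invfM sumrN; ring.
Qed.

Lemma risk_ge_partial_sum (delta : estimator R m) (l : 'rV[R]_m) N K :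
  pos_param l ->
  ((\sum_(x : {ffun 'I_m -> 'I_N}) \sum_(y < K)
    loss (delta (\row_j pos_exp x j) y) l *
    (likelihood (pos_exp x) y l / ((\prod_j (pos_exp x j)`!%:R) * y`!%:R)) *
    expR (- (2 * \sum_j l 0 j)))%:E <= risk P X Y delta l)%E.
Proof.
move=> l0; have mu0 := rate_gt0 m_gt0 l0.
have ind := XY_indep model l0; have law := XY_law model l0.
pose L (z : {ffun option 'I_m -> nat}) :=
  loss (delta (\row_i z (Some i)) (z None)) l.
have L0 z : 0 <= L z by exact: loss_ge0.
have -> : risk P X Y delta l =
    (\esum_(z in setT) (L z * joint_pmf (rate l) z)%:E)%E.
  rewrite -(expectation_joint mu0 ind law L0) /risk; congr expectation.
  apply/funext => w; rewrite /L ffunE; congr (loss (delta _ _) _).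
  by apply/rowP => i; rewrite !mxE ffunE.
pose phi (p : {ffun 'I_m -> 'I_N} * 'I_K) := count_vector (pos_exp p.1) p.2.
have phi_inj : injective phi.
  move=> [x y] [x' y'] /ffunP h; congr pair.
    apply/ffunP => i; apply/val_inj; have := h (Some i).
    by rewrite !ffunE => -[].
  by apply/val_inj; have := h None; rewrite !ffunE.
apply: esum_ge; exists [set` map phi (index_enum _)].
  by split => //; exact: finite_seq.
rewrite -fsbig_seq; last by rewrite map_inj_uniq ?index_enum_uniq.
rewrite big_map sumEFin lee_fin pair_bigA /= le_eqVlt; apply/orP; left; apply/eqP.
apply: eq_bigr => -[x y] _ /=; rewrite -mulrA /phi joint_pmf_count_vector // /L.
congr (loss (delta _ _) _ * _); last by rewrite ffunE.
by apply/rowP => i; rewrite !mxE ffunE.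
Qed.

Lemma sup_risk_ge (delta : estimator R m) :
  ((m%:R - 2^-1)%:E <= sup_risk P X Y delta)%E.
Proof.
(* Arguing by contradiction makes the supremum risk finite, hence a real [r] to which
   [minimax_bound] applies. *)
rewrite leNgt; apply/negP => lt_sup.
have one_pos : pos_param (const_mx 1 : 'rV[R]_m) by move=> i; rewrite mxE.
have sup0 : (0 <= sup_risk P X Y delta)%E.
  apply: le_trans (le_sup_risk delta one_pos).
  by apply: expectation_ge0 => w; exact: loss_ge0.
have [r rE] : exists r, sup_risk P X Y delta = r%:E.
  by move: lt_sup sup0; case: (sup_risk _ _ _ _) => [r| |] // _ _; exists r.
have := @minimax_bound R m m_gt0 delta r.
have -> : m.-1%:R = m%:R - 1 :> R by rewrite -subn1 natrB.
move: lt_sup; rewrite rE lte_fin => ltr H.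
suff : 1 + 2 * (m%:R - 1) <= 2 * r by lra.
apply: H => N K l l0; rewrite -lee_fin -rE.
exact: le_trans (risk_ge_partial_sum delta N K l0) (le_sup_risk delta l0).
Qed.

Lemma minimax_of_risk_le (delta : estimator R m) :
  (forall l, pos_param l -> (risk P X Y delta l <= (m%:R - 2^-1)%:E)%E) ->
  minimax P X Y delta.
Proof.
move=> le_risk; apply/eqP; rewrite eq_le; apply/andP; split.
  apply: (@le_trans _ _ (m%:R - 2^-1)%:E).
    by apply: ge_ereal_sup => _ [l l0 <-]; exact: le_risk.
  by apply: le_ereal_inf_tmp => _ [e _ <-]; exact: sup_risk_ge.
by apply: ereal_inf_lbound; exists delta.
Qed.

Lemma exists_minimax : exists delta : estimator R m,
  forall l, pos_param l -> (risk P X Y delta l <= (m%:R - 2^-1)%:E)%E.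
Proof.
have [m2|] := leqP 2 m.
  by exists (est_XY R m) => l l0; exact: risk_est_XY_le.
move=> m_le1; have m1 : m = 1%N by apply/eqP; rewrite eqn_leq m_gt0 andbT -ltnS.
exists (est_mean R m) => l l0; rewrite (risk_est_mean model m_gt0 l0 m1) lee_fin.
by rewrite {1}m1; lra.
Qed.

Lemma not_minimax (delta : estimator R m) l : pos_param l ->
  ((m%:R - 2^-1)%:E < risk P X Y delta l)%E -> ~ minimax P X Y delta.
Proof.
move=> l0 lt_risk; rewrite /minimax => E.
have [e le_e] := exists_minimax.
have := le_sup_risk delta l0; rewrite E leNgt => /negP; apply.
apply: le_lt_trans lt_risk.
apply: (@le_trans _ _ (sup_risk P X Y e)).
  by apply: ereal_inf_lbound; exists e.
by apply: ge_ereal_sup => _ [l' l'0 <-]; exact: le_e.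
Qed.

Lemma exists_param (L : R) : 0 < L ->
  exists2 l : 'rV[R]_m, pos_param l & \sum_i l 0 i = L.
Proof.
move=> L0; have m0 : 0 < m%:R :> R by rewrite ltr0n.
exists (const_mx (L / m%:R)); first by move=> i; rewrite mxE divr_gt0.
under eq_bigr do rewrite mxE.
by rewrite sumr_const card_ord -(mulr_natr (L / m%:R)) divfK // lt0r_neq0.
Qed.

Lemma est_ML_not_minimax : ~ minimax P X Y (est_ML R m).
Proof.
have m1 : 1 <= m%:R :> R by rewrite ler1n.
have [|l l0 lE] := @exists_param (2 * m%:R); first by lra.
by apply: (not_minimax l0); apply: risk_est_ML_gt => //; rewrite lE; lra.
Qed.

Lemma est_O_X_not_minimax : ~ minimax P X Y (est_O_X R m).
Proof.
have [//|l l0 _] := @exists_param 1.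
by apply: (not_minimax l0); rewrite risk_est_O_X // lte_fin; lra.
Qed.

Lemma est_X_not_minimax : ~ minimax P X Y (est_X R m).
Proof.
have [m2|m_le1] := leqP 2 m.
  have m1 : 2 <= m%:R :> R by rewrite ler_nat.
  have [|l l0 lE] := @exists_param (4 * (m%:R - 1) ^+ 2).
    by rewrite mulr_gt0 // exprn_gt0; lra.
  by apply: (not_minimax l0); exact: risk_est_X_gt.
have m1 : m = 1%N by apply/eqP; rewrite eqn_leq m_gt0 andbT -ltnS.
(* For m = 1 the estimator is x * (x / x), which is x even at x = 0, where 0 / 0 = 0. *)
rewrite (_ : est_X R m = est_O_X R m); first exact: est_O_X_not_minimax.
apply/funext => x; apply/funext => y; apply/rowP => i.
rewrite /est_X /est_O_X /Defs.total /vec !mxE.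
have -> : m%:R = 1 :> R by rewrite m1.
rewrite addrK.
move: x i; rewrite m1 => x i; rewrite big_ord1 (ord1 i).
by have [->|x0] := eqVneq (x 0 0)%:R (0 : R); rewrite ?mul0r // mulVf // mulr1.
Qed.

End minimax_value.

Theorem theorem2p3 (R : realType) (m : nat) (m_gt0 : (0 < m)%N)
    (d : measure_display) (T : measurableType d)
    (P : 'rV[R]_m -> probability T R)
    (X : 'I_m -> {mfun T >-> nat}) (Y : {mfun T >-> nat})
    (model : Poisson_model P X Y) :
  [/\ ((2 <= m)%N ->
         minimax P X Y (est_O_XY R m) /\ minimax P X Y (est_XY R m)) /\
      (m = 1%N ->
         [/\ ~ minimax P X Y (est_O_XY R m),
             ~ minimax P X Y (est_XY R m),
             minimax P X Y (est_mean R m) &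
             forall l : 'rV[R]_m, pos_param l ->
               risk P X Y (est_mean R m) l = (2^-1)%:E]),
      ~ minimax P X Y (est_ML R m) &
      ~ minimax P X Y (est_O_X R m) /\ ~ minimax P X Y (est_X R m)].
Proof.
have ML := est_ML_not_minimax model m_gt0.
split; [split|exact: ML|]; last first.
- by split; [exact: est_O_X_not_minimax|exact: est_X_not_minimax].
- move=> m1.
  have mR : m%:R = 1 :> R by rewrite m1.
  (* For m = 1 the shift m - 1 vanishes and all three estimators based on (X, Y) coincide, including
     at x = 0. *)
  have E0 : est_XY R m = est_ML R m.
    apply/funext => x; apply/funext => y.
    by rewrite /est_XY /est_ML mR addrK.
  have E1 : est_O_XY R m = est_ML R m.
    apply/funext => x; apply/funext => y.
    by rewrite /est_O_XY /est_ML mR !addrK.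
  rewrite E0 E1; split=> // [|l l0]; last exact: risk_est_mean.
  apply: minimax_of_risk_le => // l l0.
  by rewrite (risk_est_mean model m_gt0 l0 m1) lee_fin {1}m1; lra.
move=> m2; split; apply: minimax_of_risk_le => // l l0.
  exact: risk_est_O_XY_le.
exact: risk_est_XY_le.
Qed.
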